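(* Let $0\le J<K$ be integers, let $\Psi=\{\alpha;\beta^1,\ldots,\beta^r\}$ be generators and $\Theta=\{a;b^1,\ldots,b^r\}$ a filter bank as in the context. Assume that the refinement relations $$\widehat\alpha(2\xi)=\widehat a(\xi)\widehat\alpha(\xi),\qquad \widehat{\beta^k}(2\xi)=\widehat{b^k}(\xi)\widehat\alpha(\xi),\quad k=1,\ldots,r,$$ hold and that $$\left|\widehat a(\lambda_\ell/2^j)\right|^2+\sum_{k=1}^r\left|\widehat{b^k}(\lambda_\ell/2^j)\right|^2=1,\qquad \ell\in\Lambda_j^\alpha,\quad j=J+1,\ldots,K.$$ (i) If the analysis operator $\mathcal A_{J,K}$ is formed from fixed-tolerance nested Marcinkiewicz--Zygmund measures for $p=2$ with tolerance $0<\eta<1$ (see context), then $$(1-\eta)\|\widehat{\mathbf z}\|_2^2\le\|\mathcal A_{J,K}\widehat{\mathbf z}\|_2^2\le(1+\eta)\|\widehat{\mathbf z}\|_2^2\qquad\text{for all }\widehat{\mathbf z}\in\mathbb C^{\Lambda_K^\alpha}.$$ (ii) If $\{\boldsymbol X_j,w_{j,x}\}_{j\ge0}$ is a nested weighted family constructed with a fixed parameter $0<\gamma<R_{\mathcal M}$ (see context), $C_{\mathcal M}:=2\gamma/c$ with $c=c(\mathcal M,1,2)$ the Filbir--Mhaskar constant for $p=2$, $\kappa=1$ (see context), and $s\ge0$ is an integer with $\rho_s:=C_{\mathcal M}2^{-s}<1$, then the oversampled analysis operator $\mathcal A_{J,K}^{(s)}$ satisfies the same inequality with $\eta$ replaced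 by $\rho_s$. Both conclusions remain valid after restriction to a spectral subspace (i.e. to vectors $\widehat{\mathbf z}$ supported on a subset of $\Lambda_K^\alpha$). In either case, let $\mathcal T=\mathcal A_{J,K}$, $\varepsilon=\eta$ in (i), and $\mathcal T=\mathcal A_{J,K}^{(s)}$, $\varepsilon=\rho_s$ in (ii). Then $\mathbf S_{\mathcal T}:=\mathcal T^*\mathcal T$ is a positive-definite self-adjoint operator on $\mathbb C^{\Lambda_K^\alpha}$, and, with $\lambda_{\min}(\mathbf S_{\mathcal T})$, $\lambda_{\max}(\mathbf S_{\mathcal T})$ its smallest and largest eigenvalues, $$\kappa(\mathbf S_{\mathcal T}):=\frac{\lambda_{\max}(\mathbf S_{\mathcal T})}{\lambda_{\min}(\mathbf S_{\mathcal T})}\le\frac{1+\varepsilon}{1-\varepsilon}.$$ Moreover, writing $\|\widehat{\mathbf z}\|_{\mathbf S_{\mathcal T}}:=\langle\mathbf S_{\mathcal T}\widehat{\mathbf z},\widehat{\mathbf z}\rangle^{1/2}$, if $\mathbf c$ is any element of the codomain of $\mathcal T$, $\widehat{\mathbf u}_K$ solves $\mathbf S_{\mathcal T}\widehat{\mathbf u}_K=\mathcal T^*\mathbf c$, and $\widehat{\mathbf u}_K^{(m)}$ is the $m$th conjugate-gradient iterate for this equation, then $$\|\widehat{\mathbf u}_K^{(m)}-\widehat{\mathbf u}_K\|_{\mathbf S_{\mathcal T}}\le2\left(\frac{\sqrt{\kappa(\mathbf S_{\mathcal T})}-1}{\sqrt{\kappa(\mathbf S_{\mathcal T})}+1}\right)^m\|\widehat{\mathbf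 u}_K^{(0)}-\widehat{\mathbf u}_K\|_{\mathbf S_{\mathcal T}}.$$
   Context: $(\mathcal M,g)$ is a compact, connected, $d$-dimensional smooth Riemannian manifold without boundary, $\mu$ its Riemannian volume measure normalized so that $\mu(\mathcal M)=1$, $\operatorname{dist}$ the geodesic distance, $B(x,R)=\{y:\operatorname{dist}(x,y)\le R\}$. Constants $R_{\mathcal M},c_1,c_2>0$ depending only on $\mathcal M$ are fixed with $c_1R^d\le\mu(B(x,R))\le c_2R^d$ for $x\in\mathcal M$, $0<R\le R_{\mathcal M}$. $\{u_\ell\}_{\ell\ge0}$ is an orthonormal basis of $L^2(\mu)$ with $-\Delta_{\mathcal M}u_\ell=\lambda_\ell^2u_\ell$, $0=\lambda_0\le\lambda_1\le\cdots\to\infty$; $\mathbb P_n=\operatorname{span}\{u_\ell:\lambda_\ell\le n\}$. Generators and filters: $\alpha,\beta^k\in L_1(\mathbb R)$, $\widehat h(\xi)=\int_{\mathbb R}h(t)e^{-2\pi it\xi}dt$, with $(\operatorname{supp}\widehat\alpha\cap[0,\infty))\cup\bigcup_k(\operatorname{supp}\widehat{\beta^k}\cap[0,\infty))\subset[0,1]$; $a,b^k\in\ell_1(\mathbb Z)$ with symbols $\widehat a(\xi)=\sum_{m\in\mathbb Z}a_me^{-2\pi im\xi}$, $\widehat{b^k}(\xi)=\sum_{m\in\mathbb Z}b^k_me^{-2\pi im\xi}$. Active index sets: $\Lambda_j^\alpha=\{\ell\ge0:\widehat\alpha(\lambda_\ell/2^j)\ne0\}\subset\{\ell:\lambda_\ell\le2^j\}$,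 $j\ge J$; it is assumed that $\Lambda_{j-1}^\alpha\subset\Lambda_j^\alpha$. Analysis operator: given finite sets $\boldsymbol X_j\subset\mathcal M$ with positive weights $w_{j,x}$, let $\mathbf F_j:\mathbb C^{\Lambda_j^\alpha}\to\mathbb C^{\boldsymbol X_j}$, $(\mathbf F_j\widehat{\mathbf z})(x)=\sum_{\ell\in\Lambda_j^\alpha}z_\ell w_{j,x}^{1/2}u_\ell(x)$. For $\widehat{\mathbf v}_K\in\mathbb C^{\Lambda_K^\alpha}$ and $j=K,K-1,\ldots,J+1$ set $\widehat w^k_{j-1,\ell}=\widehat v_{j,\ell}\overline{\widehat{b^k}(\lambda_\ell/2^j)}$ ($\ell\in\Lambda_j^\alpha$), $\mathbf w^k_{j-1}=\mathbf F_j\widehat{\mathbf w}^k_{j-1}\in\mathbb C^{\boldsymbol X_j}$, and $\widehat v_{j-1,\ell}=\widehat v_{j,\ell}\overline{\widehat a(\lambda_\ell/2^j)}$ ($\ell\in\Lambda_{j-1}^\alpha$); finally $\mathbf v_J=\mathbf F_J\widehat{\mathbf v}_J$. Then $\mathcal A_{J,K}:\mathbb C^{\Lambda_K^\alpha}\to\mathbb C^{\boldsymbol X_J}\times\prod_{j=J+1}^K(\mathbb C^{\boldsymbol X_j})^r$, $\mathcal A_{J,K}\widehat{\mathbf v}_K=(\mathbf v_J,\{\mathbf w^k_{j-1}\}_{J<j\le K,\,1\le k\le r})$. All spaces carry standard Euclidean inner products, and $^*$ is the adjoint. $\mathcal A_{J,K}^{(s)}$ is defined by the same spectral filtering steps with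 each $\mathbf F_j$ replaced by $\mathbf F_j^{(s)}:\mathbb C^{\Lambda_j^\alpha}\to\mathbb C^{\boldsymbol X_{j+s}}$, $(\mathbf F_j^{(s)}\widehat{\mathbf z})(x)=\sum_{\ell\in\Lambda_j^\alpha}z_\ell w_{j+s,x}^{1/2}u_\ell(x)$. Fixed-tolerance nested Marcinkiewicz--Zygmund measures ($p=2$, tolerance $\eta$): nested finite sets $\boldsymbol X_j\subset\boldsymbol X_{j+1}$, $j\ge0$, with positive weights and a parameter $\gamma_{\eta,2,\mathcal M}>0$ such that $|\boldsymbol X_j|\asymp\gamma_{\eta,2,\mathcal M}^{-d}2^{jd}$, $w_{j,x}\asymp\gamma_{\eta,2,\mathcal M}^d2^{-jd}$ (constants depending only on $\mathcal M$), and $(1-\eta)\|P\|_{L^2(\mu)}^2\le\sum_{x\in\boldsymbol X_j}w_{j,x}|P(x)|^2\le(1+\eta)\|P\|_{L^2(\mu)}^2$ for all $P\in\mathbb P_{2^j}$, $j\ge0$. For a finite $\boldsymbol X\subset\mathcal M$: $h_{\boldsymbol X}=\sup_{y\in\mathcal M}\min_{x\in\boldsymbol X}\operatorname{dist}(y,x)$, $\operatorname{sep}(\boldsymbol X)=\min_{x\ne y\in\boldsymbol X}\operatorname{dist}(x,y)$ ($+\infty$ for a one-point set). Nested weighted family constructed with parameter $\gamma$: with $R_j=\gamma2^{-j}$, finite sets with $\boldsymbol X_j\subset\boldsymbol X_{j+1}$, $h_{\boldsymbol X_j}\le R_j$, $\operatorname{sep}(\boldsymbol X_j)\ge R_j$,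 $|\boldsymbol X_j|\asymp R_j^{-d}$, and $w_{j,x}=\mu(Y_{j,x})$, where $\{Y_{j,x}\}_{x\in\boldsymbol X_j}$ is the Borel partition of $\mathcal M$ assigning each point to a nearest node of $\boldsymbol X_j$ (ties to the first nearest node in a fixed ordering). Filbir--Mhaskar constant: by a known theorem, for $\kappa\ge1$, $1\le p<\infty$ there is $c=c(\mathcal M,\kappa,p)>0$ (fixed) such that: if $0<\eta<1$, $n\ge1$, $\boldsymbol X$ is finite with $h_{\boldsymbol X}\le\kappa\operatorname{sep}(\boldsymbol X)$, $\{Y_x\}_{x\in\boldsymbol X}$ is a measurable partition of $\mathcal M$ with $x\in Y_x\subset B(x,h_{\boldsymbol X})$, and $n\,h_{\boldsymbol X}\le c\,\eta/p$, then $\left|\int|P|^pd\mu-\sum_{x\in\boldsymbol X}\mu(Y_x)|P(x)|^p\right|\le\eta\int|P|^pd\mu$ for all $P\in\mathbb P_n$. Conjugate gradients for $\mathbf S\mathbf u=\mathbf b$ (exact arithmetic): $\mathbf u^{(0)}=0$, $\mathbf r_0=\mathbf p_0=\mathbf b$; while $\mathbf r_m\ne0$: $\theta_m=\langle\mathbf r_m,\mathbf r_m\rangle/\langle\mathbf p_m,\mathbf S\mathbf p_m\rangle$, $\mathbf u^{(m+1)}=\mathbf u^{(m)}+\theta_m\mathbf p_m$, $\mathbf r_{m+1}=\mathbf r_m-\theta_m\mathbf S\mathbf p_m$, $\delta_m=\langle\mathbf r_{m+1},\mathbf r_{m+1}\rangle/\langle\mathbf r_m,\mathbf r_m\rangle$,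 $\mathbf p_{m+1}=\mathbf r_{m+1}+\delta_m\mathbf p_m$. Here $\mathbf S=\mathbf S_{\mathcal T}$, $\mathbf b=\mathcal T^*\mathbf c$. *)

(* Defs.v *)
From HB Require Import structures.
From mathcomp Require Import all_boot all_order all_algebra.
From mathcomp Require Import finmap.
From mathcomp Require Import all_classical all_reals all_analysis.
From mathcomp Require Import ring.

Set Implicit Arguments.
Unset Strict Implicit.
Unset Printing Implicit Defensive.

Import Order.TTheory GRing.Theory Num.Theory.
Import numFieldNormedType.Exports.
From mathcomp Require Import complex.

Local Open Scope classical_set_scope.
Local Open Scope ring_scope.
Local Open Scope complex_scope.

Definition cabs (R : realType) (z : R[i]) : R := Normc.normc z.

Section Smooth.
Context {R : realType} {d : nat}.
Implicit Types (f : 'rV[R]_d -> R) (U : set 'rV[R]_d).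

Definition partial (a : 'I_d) f (v : 'rV[R]_d) : R := 'D_(delta_mx 0 a) f v.

Fixpoint Ck (k : nat) U f : Prop :=
  (forall v, U v -> {for v, continuous f}) /\
  if k is k'.+1 then
    forall a : 'I_d, (forall v, U v -> derivable f v (delta_mx 0 a)) /\
                     Ck k' U (partial a f)
  else True.

(* Only used on open sets [U]. *)
Definition smooth_on U f := forall k, Ck k U f.

Definition C1_curve (c : R -> 'rV[R]_d) :=
  (forall t, derivable c t 1) /\ continuous (derive1 c).

End Smooth.

(* The Lebesgue integral over R^d of a nonnegative Borel function, written as
   an iterated integral (Tonelli). *)
Fixpoint lebesgue_int {R : realType} (d : nat) :
    ('rV[R]_d -> \bar R) -> \bar R :=
  if d is d'.+1 return ('rV[R]_d -> \bar R) -> \bar R then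
    fun f => (\int[lebesgue_measure]_t
      lebesgue_int (fun v : 'rV[R]_d' =>
        f (row_mx (t%:M : 'rV[R]_1) v : 'rV[R]_d'.+1)))%E
  else fun f => f 0.

(* Compact connected smooth Riemannian manifolds without boundary, by an
   atlas.  [cinv i] is the inverse of the chart [cmap i : cdom i -> R^d], and
   [metric i v] is the Gram matrix, at the point of coordinates [v], of the
   coordinate vector fields of the chart [i].  All maps are total; their values
   outside [cdom i], resp. [cmap i @` cdom i], are irrelevant.  The Jacobian
   matrix ['J f p] acts on row vectors on the right. *)
Record compact_riemannian (R : realType) (d : nat) := CompactRiemannian {
  mpoint :> ptopologicalType ;
  mcompact : compact [set: mpoint] ;
  mconnected : connected [set: mpoint] ;
  mhausdorff : hausdorff_space mpoint ;
  chart : Type ;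
  cdom : chart -> set mpoint ;
  cmap : chart -> mpoint -> 'rV[R]_d ;
  cinv : chart -> 'rV[R]_d -> mpoint ;
  cdom_open : forall i, open (cdom i) ;
  cdom_cover : forall x, exists i, cdom i x ;
  cimg_open : forall i, open (cmap i @` cdom i) ;
  cmapK : forall i x, cdom i x -> cinv i (cmap i x) = x ;
  cmap_continuous : forall i x, cdom i x -> {for x, continuous (cmap i)} ;
  cinv_continuous : forall i v, (cmap i @` cdom i) v ->
    {for v, continuous (cinv i)} ;
  transition_smooth : forall i j (a : 'I_d),
    smooth_on (cmap i @` (cdom i `&` cdom j))
              (fun v => cmap j (cinv i v) 0 a) ;
  metric : chart -> 'rV[R]_d -> 'M[R]_d ;
  metric_smooth : forall i (a b : 'I_d),
    smooth_on (cmap i @` cdom i) (fun v => metric i v a b) ;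
  metric_symmetric : forall i v, (cmap i @` cdom i) v ->
    (metric i v)^T = metric i v ;
  metric_posdef : forall i v, (cmap i @` cdom i) v ->
    forall h : 'rV[R]_d, h != 0 -> 0 < (h *m metric i v *m h^T) 0 0 ;
  metric_compat : forall i j x, cdom i x -> cdom j x ->
    metric i (cmap i x) =
      jacobian (cmap j \o cinv i) (cmap i x) *m metric j (cmap j x) *m
      (jacobian (cmap j \o cinv i) (cmap i x))^T }.

Definition borel (T : ptopologicalType) := g_sigma_algebraType (@open T).

Section Geometry.
Context {R : realType} {d : nat} (M : compact_riemannian R d).
Local Open Scope ereal_scope.

Definition cimg (i : chart M) : set 'rV[R]_d := cmap i @` cdom i.

Definition arc_length (i : chart M) (c : R -> 'rV[R]_d) : \bar R :=
  \int[lebesgue_measure]_(t in `[0%R, 1%R])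
    (Num.sqrt ((derive1 c t *m metric i (c t) *m (derive1 c t)^T) 0%R 0%R))%:E.

(* [path_length x y L]: there is a piecewise C^1 curve of length [L] from [x]
   to [y].  It is cut into finitely many C^1 arcs, each inside one chart. *)
Inductive path_length (x : M) : M -> \bar R -> Prop :=
| path_nil : path_length x x 0
| path_arc (i : chart M) (c : R -> 'rV[R]_d) (L : \bar R) :
    path_length x (cinv i (c 0%R)) L -> C1_curve c ->
    (forall t : R, (0 <= t <= 1)%R -> cimg i (c t)) ->
    path_length x (cinv i (c 1%R)) (L + arc_length i c).

Definition geodist (x y : M) : \bar R := ereal_inf [set L | path_length x y L].

Definition cball (x : M) (r : \bar R) : set M := [set y | geodist x y <= r].

Definition sqrt_det (i : chart M) (v : 'rV[R]_d) : R :=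
  Num.sqrt (\det (metric i v)).

(* [V] is the total Riemannian volume. *)
Definition normalized_volume (mu : probability (borel M) R) :=
  exists2 V : R, (0 < V)%R &
    forall (i : chart M) (A : set (borel M)), measurable A -> A `<=` cdom i ->
      V%:E * mu A =
      lebesgue_int (fun v => (\1_(cmap i @` A) v * sqrt_det i v)%:E).

Definition smooth_fun (f : M -> R) :=
  forall i : chart M, smooth_on (cimg i) (f \o cinv i).

(* The Laplace-Beltrami operator in the coordinates of a chart. *)
Definition laplacian (i : chart M) (f : M -> R) (v : 'rV[R]_d) : R :=
  ((sqrt_det i v)^-1 * \sum_(a < d) partial a (fun y => sqrt_det i y *
     \sum_(b < d) invmx (metric i y) a b * partial b (f \o cinv i) y) v)%R.

(* [-Delta f = e f] *)
Definition laplace_eigenfun (f : M -> R) (e : R) :=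
  smooth_fun f /\
  forall (i : chart M) (x : M), cdom i x ->
    (- laplacian i f (cmap i x) = e * f x)%R.

(* Nodes are enumerated without repetition by a sequence.  [geodist] is
   symmetric. *)
Definition fill_distance (X : seq M) : \bar R :=
  ereal_sup [set \big[mine/+oo]_(x <- X) geodist x y | y in [set: M]].

Definition separation (X : seq M) : \bar R :=
  ereal_inf [set geodist p.1 p.2 | p in
    [set p : M * M | [/\ p.1 \in X, p.2 \in X & p.1 != p.2]]].

(* Ties go to the first nearest node in the order of [X]. *)
Definition voronoi (X : seq M) (x : M) : set (borel M) :=
  [set y : M | forall x' : M, x' \in X ->
    geodist x y <= geodist x' y /\
    ((index x' X < index x X)%N -> geodist x y < geodist x' y)].

Definition ball_regular (mu : probability (borel M) R) (RM c1 c2 : R) :=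
  [/\ (0 < RM)%R, (0 < c1)%R, (0 < c2)%R &
   forall (x : M) (r : R), (0 < r <= RM)%R ->
    (c1 * r ^+ d)%:E <= mu (cball x r%:E) /\
    mu (cball x r%:E) <= (c2 * r ^+ d)%:E].

End Geometry.

Section ComplexFunctions.
Context {R : realType}.

Definition cintegral disp (T : measurableType disp)
    (mu : {measure set T -> \bar R}) (f : T -> R[i]) : R[i] :=
  (\int[mu]_x Re (f x)) +i* (\int[mu]_x Im (f x)).

Definition in_L1 disp (T : measurableType disp)
    (mu : {measure set T -> \bar R}) (f : T -> R[i]) :=
  mu.-integrable [set: T] (fun x => (Re (f x))%:E) /\
  mu.-integrable [set: T] (fun x => (Im (f x))%:E).

Definition in_L2 disp (T : measurableType disp)
    (mu : {measure set T -> \bar R}) (f : T -> R[i]) :=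
  [/\ measurable_fun [set: T] (fun x => Re (f x)),
      measurable_fun [set: T] (fun x => Im (f x)) &
      (\int[mu]_x ((cabs (f x) ^+ 2)%:E) < +oo)%E].

Definition expi (t : R) : R[i] := cos t +i* sin t.

Definition fourier (h : R -> R[i]) (xi : R) : R[i] :=
  cintegral lebesgue_measure (fun t => h t * expi (- (2 * pi * t * xi))).

Definition in_l1 (a : int -> R[i]) :=
  summable [set: int] (fun m => (cabs (a m))%:E).

(* Sum over Z of an absolutely summable family, as the limit of its symmetric
   partial sums. *)
Definition zsum (f : int -> R) : R :=
  limn (fun N : nat => \sum_(k < N.*2.+1) f (k%:Z - N%:Z)).

Definition symbol (a : int -> R[i]) (xi : R) : R[i] :=
  let term (m : int) := a m * expi (- (2 * pi * m%:~R * xi)) in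
  zsum (fun m => Re (term m)) +i* zsum (fun m => Im (term m)).

Definition supp_in_unit (f : R -> R[i]) :=
  closure [set xi | f xi != 0] `&` `[0, +oo[ `<=` `[0, 1].

Definition generators_filters (r : nat)
    (alpha : R -> R[i]) (beta : 'I_r -> R -> R[i])
    (a : int -> R[i]) (b : 'I_r -> int -> R[i]) :=
  [/\ in_L1 lebesgue_measure alpha /\
        (forall k, in_L1 lebesgue_measure (beta k)),
      supp_in_unit (fourier alpha) /\
        (forall k, supp_in_unit (fourier (beta k))) &
      in_l1 a /\ (forall k, in_l1 (b k))].

(* [Lambda_j^alpha].  The set is finite for the data considered here, as
   [lam l] tends to infinity. *)
Definition active (alpha : R -> R[i]) (lam : nat -> R) (j : nat) : {fset nat} :=
  fset_set [set l | fourier alpha (lam l / 2 ^+ j) != 0].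

End ComplexFunctions.

Section Spectral.
Context {R : realType} {d : nat} (M : compact_riemannian R d).
Context (mu : probability (borel M) R).
Context (u : nat -> M -> R[i]) (lam : nat -> R).

(* [u l] is the smooth representative of its class. *)
Record eigenbasis : Prop := Eigenbasis {
  eb_eigen_Re : forall l, laplace_eigenfun (fun x => Re (u l x)) (lam l ^+ 2) ;
  eb_eigen_Im : forall l, laplace_eigenfun (fun x => Im (u l x)) (lam l ^+ 2) ;
  eb_lam0 : lam 0 = 0 ;
  eb_lam_le : forall l, lam l <= lam l.+1 ;
  eb_lam_oo : lam @ \oo --> +oo ;
  eb_L2 : forall l, in_L2 mu (u l) ;
  eb_orthonormal : forall k l,
    cintegral mu (fun x => u k x * (u l x)^*) = (k == l)%:R ;
  eb_total : forall f : borel M -> R[i], in_L2 mu f -> forall e : R, 0 < e ->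
    exists (N : nat) (z : nat -> R[i]),
      (\int[mu]_x ((cabs (f x - \sum_(l < N) z l * u l x)%R ^+ 2)%:E) < e%:E)%E
}.

(* The space P_n of diffusion polynomials. *)
Definition diffusion_poly (n : R) (P : M -> R[i]) :=
  exists (N : nat) (z : nat -> R[i]),
    (forall l, z l != 0 -> lam l <= n) /\
    P = (fun x => \sum_(l < N) z l * u l x).

Definition filbir_mhaskar (kappa p c : R) :=
  0 < c /\
  forall (eta : R) (n : nat) (X : seq M) (Y : M -> set (borel M)),
    0 < eta < 1 -> (1 <= n)%N -> uniq X ->
    (fill_distance X <= kappa%:E * separation X)%E ->
    (forall x, x \in X -> measurable (Y x)) ->
    (forall y : M, exists2 x, x \in X & Y x y) ->
    (forall x x' y, x \in X -> x' \in X -> Y x y -> Y x' y -> x = x') ->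
    (forall x, x \in X -> Y x x /\ Y x `<=` cball x (fill_distance X)) ->
    (n%:R%:E * fill_distance X <= (c * eta / p)%:E)%E ->
    forall P, diffusion_poly n%:R P ->
      `| \int[mu]_x (cabs (P x) `^ p)
         - \sum_(x <- X) fine (mu (Y x)) * cabs (P x) `^ p |
      <= eta * \int[mu]_x (cabs (P x) `^ p).

(* Fixed-tolerance nested Marcinkiewicz-Zygmund measures for p = 2; the
   constants [C1], ..., [C4] are those of the two-sided estimates. *)
Record nested_MZ (C1 C2 C3 C4 eta gamma : R)
    (X : nat -> seq M) (w : nat -> M -> R) : Prop := NestedMZ {
  mz_uniq : forall j, uniq (X j) ;
  mz_nested : forall j, {subset X j <= X j.+1} ;
  mz_gamma : 0 < gamma ;
  mz_weight_gt0 : forall j x, x \in X j -> 0 < w j x ;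
  mz_card : forall j,
    C1 * (gamma ^- d * 2 ^+ (j * d)) <= (size (X j))%:R
      <= C2 * (gamma ^- d * 2 ^+ (j * d)) ;
  mz_weight : forall j x, x \in X j ->
    C3 * (gamma ^+ d * 2 ^- (j * d)) <= w j x
      <= C4 * (gamma ^+ d * 2 ^- (j * d)) ;
  mz_ineq : forall j P, diffusion_poly (2 ^+ j) P ->
    (1 - eta) * \int[mu]_x (cabs (P x) ^+ 2)
      <= \sum_(x <- X j) w j x * cabs (P x) ^+ 2
      <= (1 + eta) * \int[mu]_x (cabs (P x) ^+ 2) }.

(* Nested weighted family constructed with parameter [gamma], with
   [R_j = gamma / 2 ^+ j]. *)
Record nested_voronoi (C1 C2 gamma : R)
    (X : nat -> seq M) (w : nat -> M -> R) : Prop := NestedVoronoi {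
  nv_uniq : forall j, uniq (X j) ;
  nv_nested : forall j, {subset X j <= X j.+1} ;
  nv_fill : forall j, (fill_distance (X j) <= (gamma / 2 ^+ j)%:E)%E ;
  nv_sep : forall j, ((gamma / 2 ^+ j)%:E <= separation (X j))%E ;
  nv_card : forall j,
    C1 * (gamma / 2 ^+ j) ^- d <= (size (X j))%:R
      <= C2 * (gamma / 2 ^+ j) ^- d ;
  nv_borel : forall j x, x \in X j -> measurable (voronoi (X j) x) ;
  nv_weight : forall j x, x \in X j -> w j x = fine (mu (voronoi (X j) x)) }.

End Spectral.

Section Analysis.
Context {R : realType} {d : nat} {M : compact_riemannian R d}.
Context (u : nat -> M -> R[i]) (lam : nat -> R).
Context {r : nat} (alpha : R -> R[i]) (a : int -> R[i]) (b : 'I_r -> int -> R[i]).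
Context (X : nat -> seq M) (w : nat -> M -> R) (J K : nat).

Definition coef (j : nat) := {ffun active alpha lam j -> R[i]}.

Definition synth (j : nat) (z : coef j) : {ffun seq_sub (X j) -> R[i]} :=
  [ffun x => \sum_l z l * (Num.sqrt (w j (val x)))%:C * u (val l) (val x)].

(* The vectors [v_j] are extended by zero outside [Lambda_j]; [vhat z n] is
   the one of level [K - n]. *)
Fixpoint vhat (z : coef K) (n : nat) (l : nat) : R[i] :=
  if n is n'.+1 then
    if l \in active alpha lam (K - n) then
      vhat z n' l * (symbol a (lam l / 2 ^+ (K - n')))^*
    else 0
  else if insub l is Some i then z i else 0.

Definition vlevel (z : coef K) (j : nat) (l : nat) : R[i] := vhat z (K - j) l.

(* The set of coordinates of the codomain: [X_J], and for each level
   [j = J + i + 1] with [J < j <= K] and each [k], the set [X_j]. *)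
Definition frame_index : finType :=
  (seq_sub (X J) + {i : 'I_(K - J) & 'I_r * seq_sub (X (J + i.+1))})%type.

Definition analysis (z : coef K) : {ffun frame_index -> R[i]} :=
  [ffun o : frame_index => match o with
   | inl x => synth (j := J) [ffun l => vlevel z J (val l)] x
   | inr (existT i (k, x)) =>
       synth (j := J + i.+1)
         [ffun l => vlevel z (J + i.+1) (val l) *
            (symbol (b k) (lam (val l) / 2 ^+ (J + i.+1)))^*] x
   end].

End Analysis.

Arguments coef {R} lam alpha j.
Arguments analysis {R d M} u lam {r} alpha a b X w J K z.

Section Operators.
Context {R : realType}.

Definition cdot {I : finType} (x y : {ffun I -> R[i]}) : R[i] :=
  \sum_i x i * (y i)^*.

Definition sqnorm {I : finType} (x : {ffun I -> R[i]}) : R :=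
  \sum_i cabs (x i) ^+ 2.

(* The adjoint of a linear map, by its coordinates [<T^* c, e_i>]. *)
Definition adj {I I' : finType}
    (T : {ffun I -> R[i]} -> {ffun I' -> R[i]}) (c : {ffun I' -> R[i]}) :
    {ffun I -> R[i]} :=
  [ffun i => cdot c (T [ffun i' => (i' == i)%:R])].

Definition gram {I I' : finType} (T : {ffun I -> R[i]} -> {ffun I' -> R[i]}) :
  {ffun I -> R[i]} -> {ffun I -> R[i]} := adj T \o T.

Section Endo.
Context {I : finType} (S : {ffun I -> R[i]} -> {ffun I -> R[i]}).

Definition selfadjoint := forall x y, cdot (S x) y = cdot x (S y).

Definition posdef := forall x, x != 0 -> 0 < cdot (S x) x.

Definition is_eigenvalue (e : R[i]) :=
  exists2 x : {ffun I -> R[i]}, x != 0 & S x = [ffun i => e * x i].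

Definition energy_norm (x : {ffun I -> R[i]}) : R :=
  Num.sqrt (Re (cdot (S x) x)).

(* Comparisons in [R[i]] with a real number imply that the other side is
   real. *)
Definition smallest_eigenvalue (e : R) :=
  is_eigenvalue e%:C /\ forall e', is_eigenvalue e' -> e%:C <= e'.

Definition largest_eigenvalue (e : R) :=
  is_eigenvalue e%:C /\ forall e', is_eigenvalue e' -> e' <= e%:C.

Record cg_state := CGState {
  cg_u : {ffun I -> R[i]} ; cg_r : {ffun I -> R[i]} ; cg_p : {ffun I -> R[i]} }.

(* Once the residual vanishes the iterate stays constant. *)
Definition cg_step (s : cg_state) : cg_state :=
  let: CGState x res p := s in
  if res == 0 then s else
  let theta := cdot res res / cdot p (S p) in
  let res' := [ffun i => res i - theta * S p i] in
  let delta := cdot res' res' / cdot res res in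
  CGState [ffun i => x i + theta * p i] res' [ffun i => res' i + delta * p i].

Definition cg_iterate (rhs : {ffun I -> R[i]}) (m : nat) : {ffun I -> R[i]} :=
  cg_u (iter m cg_step (CGState 0 rhs rhs)).

End Endo.

Section Stability.
Context {I I' : finType} (T : {ffun I -> R[i]} -> {ffun I' -> R[i]}) (eps : R).

Definition frame_bounds (z : {ffun I -> R[i]}) :=
  (1 - eps) * sqnorm z <= sqnorm (T z) <= (1 + eps) * sqnorm z.

Definition cg_error_bound (kap : R) :=
  forall (c : {ffun I' -> R[i]}) (x : {ffun I -> R[i]}) (m : nat),
    gram T x = adj T c ->
    energy_norm (gram T) (cg_iterate (gram T) (adj T c) m - x) <=
    2 * ((Num.sqrt kap - 1) / (Num.sqrt kap + 1)) ^+ m *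
      energy_norm (gram T) (cg_iterate (gram T) (adj T c) 0 - x).

(* If [I] is empty the domain is the zero space and there are no
   eigenvalues. *)
Definition well_conditioned :=
  [/\ selfadjoint (gram T), posdef (gram T) &
      (0 < #|I|)%N -> exists lmin lmax : R,
        [/\ smallest_eigenvalue (gram T) lmin,
            largest_eigenvalue (gram T) lmax,
            lmax / lmin <= (1 + eps) / (1 - eps) &
            cg_error_bound (lmax / lmin)]].

End Stability.

Definition linear_map {I I' : finType}
    (T : {ffun I -> R[i]} -> {ffun I' -> R[i]}) :=
  forall (k : R[i]) (x y : {ffun I -> R[i]}),
    T [ffun i => k * x i + y i] = [ffun i => k * T x i + T y i].

Lemma adjP {I I' : finType} (T : {ffun I -> R[i]} -> {ffun I' -> R[i]}) :
  linear_map T -> forall z c, cdot (T z) c = cdot z (adj T c).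
Proof.
move=> linT z c.
pose e i : {ffun I -> R[i]} := [ffun i' => (i' == i)%:R].
have T0 : T [ffun=> 0] = [ffun=> 0].
  transitivity (T [ffun i => -1 * [ffun=> 0] i + [ffun=> 0] i]).
    by congr T; apply/ffunP => i; rewrite !ffunE mulr0 addr0.
  by rewrite linT; apply/ffunP => i; rewrite !ffunE mulN1r addNr.
have Ts (s : seq I) : T [ffun i' => \sum_(i <- s) z i * e i i'] =
    [ffun j => \sum_(i <- s) z i * T (e i) j].
  elim: s => [|i s IHs].
    rewrite -[RHS](_ : [ffun=> 0] = _); last first.
      by apply/ffunP => j; rewrite !ffunE big_nil.
    by rewrite -T0; congr T; apply/ffunP => j; rewrite !ffunE big_nil.
  have := linT (z i) (e i) [ffun i' => \sum_(i <- s) z i * e i i'].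
  rewrite IHs => H; transitivity (T [ffun i0 => z i * e i i0 +
      [ffun i' => \sum_(i <- s) z i * e i i'] i0]).
    by congr T; apply/ffunP => j; rewrite !ffunE big_cons ffunE.
  by rewrite H; apply/ffunP => j; rewrite !ffunE big_cons.
have -> : T z = [ffun j => \sum_i z i * T (e i) j].
  rewrite -Ts; congr T; apply/ffunP => j; rewrite ffunE (bigD1 j)//= ffunE eqxx.
  rewrite mulr1 big1 ?addr0// => i ij; rewrite ffunE eq_sym (negbTE ij).
  by rewrite mulr0.
rewrite /cdot; under eq_bigr do rewrite ffunE mulr_suml.
rewrite exchange_big; apply: eq_bigr => i _.
rewrite ffunE /cdot rmorph_sum mulr_sumr; apply: eq_bigr => j _.
by rewrite rmorphM /= conjCK; ring.
Qed.

End Operators.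

Lemma analysis_linear (R : realType) (d : nat) (M : compact_riemannian R d)
    (u : nat -> M -> R[i]) (lam : nat -> R) (r : nat) (alpha : R -> R[i])
    (a : int -> R[i]) (b : 'I_r -> int -> R[i])
    (X : nat -> seq M) (w : nat -> M -> R) (J K : nat) :
  linear_map (analysis u lam alpha a b X w J K).
Proof.
move=> k x y.
have hlin n l : vhat a [ffun i => k * x i + y i] n l =
    k * vhat a x n l + vhat a y n l.
  elim: n => [|n IHn] /=.
    by case: insub => [i|]; rewrite ?ffunE// mulr0 addr0.
  by case: ifP => _; rewrite ?mulr0 ?addr0// IHn mulrDl mulrA.
have hsyn j (f g h : coef lam alpha j) p : (forall l, f l = k * g l + h l) ->
    synth u X w f p = k * synth u X w g p + synth u X w h p.
  move=> fgh; rewrite !ffunE mulr_sumr -big_split; apply: eq_bigr => l _.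
  by rewrite fgh !mulrDl !mulrA.
apply/ffunP => -[p|[i [k' p]]].
  rewrite ffunE [RHS]ffunE.
  rewrite [analysis u lam alpha a b X w J K x _]ffunE.
  rewrite [analysis u lam alpha a b X w J K y _]ffunE.
  apply: hsyn => l; rewrite [LHS]ffunE /vlevel hlin.
  by congr (_ * _ + _); rewrite [RHS]ffunE.
rewrite ffunE [RHS]ffunE.
rewrite [analysis u lam alpha a b X w J K x _]ffunE.
rewrite [analysis u lam alpha a b X w J K y _]ffunE.
apply: hsyn => l; rewrite [LHS]ffunE /vlevel hlin mulrDl -mulrA.
by congr (_ * _ + _); rewrite [RHS]ffunE.
Qed.

(* Main.v *)
Require Import Defs.
From HB Require Import structures.
From mathcomp Require Import all_boot all_order all_algebra.
From mathcomp Require Import finmap.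
From mathcomp Require Import all_classical all_reals all_analysis.
From mathcomp Require Import complex.
From mathcomp Require Import measurable_realfun.
From mathcomp Require Import ring lra.
Set Implicit Arguments.
Unset Strict Implicit.
Unset Printing Implicit Defensive.
Import Order.TTheory GRing.Theory Num.Theory.
Import numFieldNormedType.Exports.
Local Open Scope classical_set_scope.
Local Open Scope ring_scope.
Local Open Scope complex_scope.

(* On one level, a Marcinkiewicz-Zygmund inequality and Parseval compare the
   energy of the samples with that of the spectral coefficients.  The partition
   of unity, together with the vanishing of [symbol a (lam l / 2 ^+ j)] for [l] in
   [Lambda_j] but not in [Lambda_(j-1)] (a consequence of the refinement relation),
   makes the spectral energies of the levels telescope, so the frame bounds add
   up.  In case (ii) the Marcinkiewicz-Zygmund inequality is the
   Filbir-Mhaskar theorem for the Voronoi partition of the level [j + s].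

   For conjugate gradients, in an eigenbasis of [S] all the iterates are
   [p(S) b] with real polynomials [p], and the recursion becomes the three-term
   recursion of the orthogonal polynomials of a discrete measure on the spectrum.
   Hence the residual polynomial minimizes the energy error among the polynomials
   with value 1 at 0, and is compared with a scaled Chebyshev polynomial. *)

(** * Chebyshev polynomials *)

Section Chebyshev.
Context {R : realType}.
Implicit Types (q : R) (y : {poly R}) (n : nat).

(* [2 q^n T_n(y / (2 q))], with [T_n] the Chebyshev polynomial; this form makes
   sense also for [q = 0], i.e. when all eigenvalues coincide. *)
Fixpoint scaled_cheb (q : R) (y : {poly R}) (n : nat) : {poly R} :=
  if n is n1.+1 then
    if n1 is n2.+1 then y * scaled_cheb q y n1 - q ^+ 2 *: scaled_cheb q y n2
    else y
  else 2%:P.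

Lemma scaled_chebSS q y n : scaled_cheb q y n.+2 =
  y * scaled_cheb q y n.+1 - q ^+ 2 *: scaled_cheb q y n.
Proof. by []. Qed.

Lemma nat_ind2 (P : nat -> Prop) :
  P 0 -> P 1 -> (forall n, P n -> P n.+1 -> P n.+2) -> forall n, P n.
Proof.
move=> P0 P1 PS n; suff: P n /\ P n.+1 by case.
by elim: n => // n [Pn PSn]; split=> //; exact: PS.
Qed.

Lemma size_scaled_cheb q y n : (size y <= 2)%N ->
  (size (scaled_cheb q y n) <= n.+1)%N.
Proof.
move=> sy; elim/nat_ind2: n => //= [|n s0 s1].
  by rewrite size_polyC pnatr_eq0.
rewrite (leq_trans (size_polyD _ _))// geq_max; apply/andP; split.
  rewrite (leq_trans (size_polyMleq _ _))//.
  by move: (leq_add sy s1); rewrite addnC; case: (_ + _)%N => //=.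
by rewrite size_polyN (leq_trans (size_scale_leq _ _))// (leq_trans s0)// leqW.
Qed.

(** The recursion becomes [cos (x + theta) + cos (x - theta) = 2 cos theta cos x] with
    [x = (n + 1) theta]. *)
Lemma scaled_cheb_cos q y n t theta : y.[t] = 2 * q * cos theta ->
  (scaled_cheb q y n).[t] = 2 * q ^+ n * cos (n%:R * theta).
Proof.
move=> yt; elim/nat_ind2: n => [|/=|n s0 s1].
- by rewrite /= hornerC mul0r cos0 expr0 !mulr1.
- by rewrite expr1 mul1r.
rewrite scaled_chebSS hornerD hornerN hornerZ hornerM s0 s1 yt.
have -> : n.+2%:R * theta = n.+1%:R * theta + theta.
  by rewrite -natr1 mulrDl mul1r.
have -> : n%:R * theta = n.+1%:R * theta - theta.
  by rewrite -natr1 mulrDl mul1r addrK.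
rewrite cosB cosD !exprS; ring.
Qed.

Lemma scaled_cheb_norm q y n t : 0 <= q -> `|y.[t]| <= 2 * q ->
  `|(scaled_cheb q y n).[t]| <= 2 * q ^+ n.
Proof.
move=> q0 yq; have [theta yE] : exists theta, y.[t] = 2 * q * cos theta.
  (* For [q = 0] the argument of [acos] is meaningless, but then [y.[t] = 0] and any angle
     serves. *)
  have [q00|qn0] := eqVneq q 0.
    exists 0; apply/eqP; rewrite q00 mulr0 mul0r -normr_le0.
    by move: yq; rewrite q00 mulr0.
  exists (acos (y.[t] / (2 * q))).
  have q2 : 0 < 2 * q by rewrite mulr_gt0// lt_neqAle eq_sym qn0.
  rewrite acosK.
    by rewrite mulrC divfK// gt_eqF.
  by rewrite in_itv/= -ler_norml normrM normfV (gtr0_norm q2) ler_pdivrMr// mul1r.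
rewrite (scaled_cheb_cos _ yE) normrM ger0_norm; last by rewrite mulr_ge0// exprn_ge0.
rewrite ler_piMr//; first by rewrite mulr_ge0// exprn_ge0.
by rewrite ler_norml cos_geN1 cos_le1.
Qed.

(** At [0] the recursion has characteristic roots [1] and [q ^+ 2], and the initial values [2] and
    [1 + q ^+ 2] select the sum of their powers. *)
Lemma scaled_cheb0 q y n : y.[0] = 1 + q ^+ 2 ->
  (scaled_cheb q y n).[0] = 1 + (q ^+ 2) ^+ n.
Proof.
move=> y0; elim/nat_ind2: n => [|/=|n s0 s1].
- by rewrite /= hornerC expr0.
- by rewrite expr1.
rewrite scaled_chebSS hornerD hornerN hornerZ hornerM s0 s1 y0 !exprS; ring.
Qed.

(** The witness is a scaled Chebyshev polynomial of an affine argument, divided by its value at [0];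
    this value is at least 1, so the division keeps the bound. *)
Lemma chebyshev_residual (l h : R) (m : nat) : 0 < l -> l <= h ->
  let q := (Num.sqrt (h / l) - 1) / (Num.sqrt (h / l) + 1) in
  0 <= q /\
  exists p : {poly R}, [/\ (size p <= m.+1)%N, p.[0] = 1 &
    forall t, l <= t <= h -> `|p.[t]| <= 2 * q ^+ m].
Proof.
move=> l0 lh q; have h0 : 0 < h by exact: lt_le_trans l0 lh.
set s := Num.sqrt (h / l) in q *.
have s1 : 1 <= s.
  rewrite -[leLHS]sqrtr1 ler_psqrt ?nnegrE//; last by rewrite divr_ge0 // ltW.
  by rewrite ler_pdivlMr// mul1r.
have sE : h = s ^+ 2 * l.
  by rewrite sqr_sqrtr ?divr_ge0 ?ltW// divfK// gt_eqF.
have s0 : 0 < s + 1 by lra.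
have q0 : 0 <= q by rewrite divr_ge0//; lra.
split=> //.
(* [y / (2 q)] maps [l, h] affinely onto [-1, 1]. *)
pose y : {poly R} := (1 + q ^+ 2) *: (1 - (2 / (l + h)) *: 'X).
have yE t : y.[t] = (1 + q ^+ 2) * (1 - 2 / (l + h) * t).
  by rewrite /y hornerZ hornerD hornerN hornerZ hornerX hornerC.
have sy : (size y <= 2)%N.
  rewrite (leq_trans (size_scale_leq _ _))// (leq_trans (size_polyD _ _))//.
  rewrite geq_max size_poly1/= size_polyN (leq_trans (size_scale_leq _ _))//.
  by rewrite size_polyX.
have yq t : l <= t <= h -> `|y.[t]| <= 2 * q.
  move=> /andP[lt th]; rewrite yE.
  (* Both [2 q / (1 + q ^+ 2)] and [(h - l) / (l + h)] equal [(s ^+ 2 - 1) / (s ^+ 2 + 1)]; this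
     dictates the factor [1 + q ^+ 2] in [y]. *)
  have -> : 2 * q = (1 + q ^+ 2) * ((h - l) / (l + h)).
    rewrite /q sE; field.
    have ls : 0 < l + s ^+ 2 * l by rewrite -sE addr_gt0.
    by rewrite !gt_eqF.
  rewrite normrM ger0_norm; last by rewrite addr_ge0// sqr_ge0.
  rewrite ler_wpM2l//; first by rewrite addr_ge0// sqr_ge0.
  have lh0 : 0 < l + h by lra.
  have -> : 1 - 2 / (l + h) * t = (l + h - 2 * t) / (l + h).
    by field; rewrite gt_eqF.
  by rewrite normrM normfV (gtr0_norm lh0) ler_pM2r ?invr_gt0// ler_norml; lra.
have D0 : 1 <= (scaled_cheb q y m).[0].
  rewrite scaled_cheb0; first by rewrite lerDl exprn_ge0// sqr_ge0.
  by rewrite yE mulr0 subr0 mulr1.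
exists ((scaled_cheb q y m).[0]^-1 *: scaled_cheb q y m); split.
- by rewrite (leq_trans (size_scale_leq _ _))// size_scaled_cheb.
- by rewrite hornerZ mulVf// gt_eqF// (lt_le_trans _ D0).
move=> t lth; rewrite hornerZ normrM.
have := scaled_cheb_norm m q0 (yq _ lth); apply: le_trans.
rewrite ler_piMl// ger0_norm ?invr_ge0 ?(le_trans _ D0)//.
by rewrite invf_le1// (lt_le_trans _ D0).
Qed.

End Chebyshev.

(** * Conjugate gradients on polynomials *)

Section KrylovPolynomials.
Context {R : realFieldType} {I : finType} (mu beta : I -> R).
Hypotheses (mu_gt0 : forall k, 0 < mu k) (beta_ge0 : forall k, 0 <= beta k).
Implicit Types p q r x y : {poly R}.

(* With [mu] the eigenvalues of [S] and [beta] the squared coordinates of the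
   right-hand side [b], [<p(S) b, q(S) b> = moment (p * q)]. *)
Definition moment p : R := \sum_k beta k * p.[mu k].

Lemma momentD p q : moment (p + q) = moment p + moment q.
Proof.
by rewrite /moment -big_split; apply: eq_bigr => k _; rewrite hornerD mulrDr.
Qed.

Lemma momentZ c p : moment (c *: p) = c * moment p.
Proof.
by rewrite /moment mulr_sumr; apply: eq_bigr => k _; rewrite hornerZ mulrCA.
Qed.

Lemma momentB p q : moment (p - q) = moment p - moment q.
Proof. by rewrite -scaleN1r momentD momentZ mulN1r. Qed.

Lemma momentX_sqr_ge0 p : 0 <= moment ('X * (p * p)).
Proof.
apply: sumr_ge0 => k _; rewrite !hornerM hornerX -expr2.
by rewrite mulr_ge0// mulr_ge0 ?sqr_ge0// ltW.
Qed.

(** The form [moment] is only semidefinite: a nonzero polynomial may vanish at every node of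
    positive weight. Hence the factor [beta k] in the conclusion. *)
Lemma moment_sqr_eq0 p k : moment (p * p) = 0 -> beta k * p.[mu k] = 0.
Proof.
move/eqP; rewrite psumr_eq0; last first.
  by move=> i _; rewrite hornerM mulr_ge0// -expr2 sqr_ge0.
by move=> /allP/(_ k (mem_index_enum k))/=; rewrite hornerM !mulf_eq0 orbb => /orP[]/eqP->;
  rewrite ?(mul0r, mulr0).
Qed.

Lemma momentX_sqr_eq0 p k : moment ('X * (p * p)) = 0 -> beta k * p.[mu k] = 0.
Proof.
move/eqP; rewrite psumr_eq0; last first.
  move=> i _; rewrite !hornerM hornerX -expr2.
  by rewrite mulr_ge0// mulr_ge0 ?sqr_ge0// ltW.
move=> /allP/(_ k (mem_index_enum k))/=; rewrite !hornerM hornerX !mulf_eq0.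
by rewrite (gt_eqF (mu_gt0 k))/= orbb => /orP[]/eqP->; rewrite ?(mul0r, mulr0).
Qed.

(* The conjugate gradient step on the polynomials [x], [r], [p] such that the
   iterate, residual and direction are [x(S) b], [r(S) b] and [p(S) b]. *)
Definition poly_cg_step (s : {poly R} * {poly R} * {poly R}) :=
  let: (x, r, p) := s in
  if moment (r * r) == 0 then s else
  let theta := moment (r * r) / moment ('X * (p * p)) in
  let r' := r - theta *: ('X * p) in
  (x + theta *: p, r', r' + (moment (r' * r') / moment (r * r)) *: p).

Definition poly_cg m := iter m poly_cg_step (0, 1, 1).

(** Orthogonality is required against all polynomials of lower degree rather than against earlier
    residuals, so the induction needs no history. By [pcg_sizepr], [p] and [r] are interchangeable
    modulo lower degree. *)
Record poly_cg_inv (m : nat) x r p : Prop := PolyCGInv {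
  pcg_sizex : (size x <= m)%N ;
  pcg_sizer : size r = m.+1 ;
  pcg_sizep : size p = m.+1 ;
  pcg_sizepr : (size (p - r)%R <= m)%N ;
  pcg_orth : forall q, (size q <= m)%N -> moment (r * q) = 0 ;
  pcg_conj : forall q, (size q <= m)%N -> moment ('X * (p * q)) = 0 }.

Lemma size_reduce (n : nat) p q : size p = n.+1 -> (size q <= n.+1)%N ->
  exists c q', (size q' <= n)%N /\ q = q' + c *: p.
Proof.
move=> sp sq; exists (q`_n / p`_n), (q - (q`_n / p`_n) *: p).
rewrite subrK; split=> //; apply/leq_sizeP => j nj.
rewrite coefB coefZ; move: nj; rewrite leq_eqVlt => /predU1P[<-|nj].
  rewrite divfK ?subrr//.
  have : lead_coef p != 0 by rewrite lead_coef_eq0 -size_poly_eq0 sp.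
  by rewrite /lead_coef sp.
by rewrite (@nth_default _ _ p j) ?sp// (@nth_default _ _ q j) ?(leq_trans sq)// mulr0 subr0.
Qed.

(** The step length makes the new residual orthogonal to the old one, and [de] makes the new
    direction conjugate to the old one; against lower degrees both relations follow from the
    invariant. *)
Lemma poly_cg_invS m x r p : r = 1 - 'X * x -> poly_cg_inv m x r p ->
  moment (r * r) != 0 ->
  let: (x', r', p') := poly_cg_step (x, r, p) in
  poly_cg_inv m.+1 x' r' p'.
Proof.
move=> rE [sx sr sp spr or cp] rr0; rewrite /= (negbTE rr0).
set th := _ / moment ('X * (p * p)); set r' := r - _; set de := _ / moment (r * r).
have rp : moment (r * p) = moment (r * r).
  by rewrite -[p in LHS](subrK r) mulrDr momentD or// add0r.
(* Otherwise [p] would vanish at all nodes of positive weight, and [moment (r * p)], which is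
   [moment (r * r)], would be zero. *)
have pAp0 : moment ('X * (p * p)) != 0.
  apply: contra rr0 => /eqP/momentX_sqr_eq0 H.
  rewrite -rp /moment big1// => k _.
  by rewrite hornerM mulrCA mulrC H mul0r.
have th0 : th != 0 by rewrite mulf_neq0// invr_eq0.
have pAr : moment ('X * (p * r)) = moment ('X * (p * p)).
  by rewrite -[r](subKr p) mulrBr mulrBr momentB (cp (p - r))// subr0.
have sXp : size ('X * p) = m.+2.
  by rewrite mulrC size_mulX ?sp// -size_poly_eq0 sp.
have sr' : size r' = m.+2.
  rewrite /r' addrC size_polyDl; first by rewrite size_polyN size_scale.
  by rewrite size_polyN size_scale// sXp sr.
have or' q : (size q <= m.+1)%N -> moment (r' * q) = 0.
  move=> /(size_reduce sr)[c [q' [sq' ->]]].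
  have E g : moment (r' * g) = moment (r * g) - th * moment ('X * (p * g)).
    by rewrite /r' mulrBl momentB -scalerAl momentZ mulrA.
  rewrite mulrDr momentD -scalerAr momentZ !E or// cp// pAr.
  by rewrite mulr0 subr0 add0r /th divfK// subrr mulr0.
(* Writing ['X * p] by two residuals reduces conjugacy of the two directions to norms of
   residuals. *)
have Xp : 'X * p = th^-1 *: (r - r').
  by rewrite /r' subKr scalerA mulVf// scale1r.
have r'Xp : moment (r' * ('X * p)) = - th^-1 * moment (r' * r').
  rewrite Xp -scalerAr mulrBr momentZ momentB (or' r) ?sr//.
  by rewrite sub0r mulNr mulrN.
split.
- rewrite (leq_trans (size_polyD _ _))// geq_max (leq_trans sx)//=.
  by rewrite (leq_trans (size_scale_leq _ _))// sp.
- by [].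
- rewrite size_polyDl// sr' ltnS.
  by rewrite (leq_trans (size_scale_leq _ _))// sp.
- by rewrite addrC addKr (leq_trans (size_scale_leq _ _))// sp.
- by [].
move=> q /(size_reduce sp)[c [q' [sq' ->]]].
rewrite mulrDr -scalerAr mulrDr momentD -scalerAr momentZ.
have E g : moment ('X * ((r' + de *: p) * g)) =
    moment (r' * ('X * g)) + de * moment ('X * (p * g)).
  by rewrite mulrDl -scalerAl mulrDr momentD -scalerAr momentZ mulrCA.
rewrite !E cp// or'; last first.
  by rewrite (leq_trans (size_polyMleq _ _))// size_polyX.
rewrite r'Xp /de /th mulr0 !add0r.
by apply/eqP; rewrite mulf_eq0; apply/orP; right; apply/eqP; field; rewrite rr0 pAp0.
Qed.

Lemma poly_cg_residual m :
  let: (x, r, p) := poly_cg m in r = 1 - 'X * x.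
Proof.
rewrite /poly_cg; elim: m => [|m] /=; first by rewrite mulr0 subr0.
case: (iter _ _ _) => [[x r] p] /= rE; case: ifP => // _.
by rewrite mulrDr -scalerAr opprD addrA -rE.
Qed.

(** Once the residual has zero norm the state is frozen, so the exact degrees of the invariant fail
    at later indices; hence the alternative. *)
Lemma poly_cg_breakdown_or_inv m :
  let: (x, r, p) := poly_cg m in
  moment (r * r) = 0 \/ poly_cg_inv m x r p.
Proof.
elim: m => [|m].
  right; split; rewrite ?size_poly0 ?size_poly1 ?subrr ?size_poly0// => q.
    by rewrite leqn0 size_poly_eq0 => /eqP->; rewrite mulr0 -(scale0r 0) momentZ mul0r.
  by rewrite leqn0 size_poly_eq0 => /eqP->; rewrite !mulr0 -(scale0r 0) momentZ mul0r.
have := poly_cg_residual m; rewrite /poly_cg iterS.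
case: (iter _ _ _) => [[x r] p] rE H.
have [rr0|rr0] := eqVneq (moment (r * r)) 0.
  by rewrite /= rr0 eqxx; left.
case: H => [/eqP|]; first by rewrite (negbTE rr0).
by move=> /(poly_cg_invS rE)/(_ rr0); case: (poly_cg_step _) => [[x' r'] p']; right.
Qed.

(** A competitor is [q = 1 - 'X * y] with [y] of size at most [m], so [q = r + 'X * (x - y)]. With
    weights [beta / mu], expanding the square gives the cross term [2 * moment (r * (x - y))], zero
    by orthogonality, and a nonnegative remainder. *)
Lemma poly_cg_optimal m q : (size q <= m.+1)%N -> q.[0] = 1 ->
  let: (x, r, p) := poly_cg m in
  \sum_k beta k / mu k * r.[mu k] ^+ 2 <= \sum_k beta k / mu k * q.[mu k] ^+ 2.
Proof.
move=> sq q0; have := poly_cg_residual m; have := poly_cg_breakdown_or_inv m.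
have w0 k : 0 <= beta k / mu k by rewrite divr_ge0// ltW.
case: (poly_cg m) => [[x r] p] [rr0 _|[sx _ _ _ or _] rE].
  (* After breakdown the residual vanishes wherever [beta] does not, so the left-hand side is
     zero. *)
  rewrite big1; first by apply: sumr_ge0 => k _; rewrite mulr_ge0 ?sqr_ge0.
  by move=> k _; rewrite mulrAC expr2 mulrA moment_sqr_eq0// !mul0r.
have /factor_theorem[y yE] : root (1 - q) 0.
  by rewrite rootE hornerD hornerN hornerC q0 subrr.
rewrite subr0 in yE.
have sy : (size y <= m)%N.
  have [->|y0] := eqVneq y 0; first by rewrite size_poly0.
  rewrite -ltnS -(size_mulX y0) -yE (leq_trans (size_polyD _ _))//.
  by rewrite geq_max size_poly1 size_polyN.
have qE : q = r + 'X * (x - y).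
  by rewrite rE mulrBr addrA subrK (mulrC 'X y) -yE subKr.
rewrite -subr_ge0 -sumrB.
suff -> : \sum_k (beta k / mu k * q.[mu k] ^+ 2 - beta k / mu k * r.[mu k] ^+ 2)
    = 2 * moment (r * (x - y)) + moment ('X * ((x - y) * (x - y))).
  rewrite or ?mulr0 ?add0r ?momentX_sqr_ge0//.
  by rewrite (leq_trans (size_polyD _ _))// geq_max sx size_polyN.
rewrite /moment mulr_sumr -big_split; apply: eq_bigr => k _ /=.
rewrite qE hornerD !hornerM hornerX; set z := (x - y).[_].
by field; rewrite gt_eqF.
Qed.

End KrylovPolynomials.

Lemma poly_cg_chebyshev {R : realType} {I : finType} (mu beta : I -> R)
    (l h : R) (m : nat) : 0 < l -> l <= h ->
  (forall k, l <= mu k <= h) -> (forall k, 0 <= beta k) ->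
  let: (x, r, p) := poly_cg mu beta m in
  \sum_k beta k / mu k * r.[mu k] ^+ 2 <=
    (2 * ((Num.sqrt (h / l) - 1) / (Num.sqrt (h / l) + 1)) ^+ m) ^+ 2 *
      \sum_k beta k / mu k.
Proof.
move=> l0 lh mulh beta0.
have mu0 k : 0 < mu k by case/andP: (mulh k) => + _; exact: lt_le_trans.
have /= [q0 [p [sp p0 pq]]] := chebyshev_residual m l0 lh.
have := poly_cg_optimal mu0 beta0 sp p0.
case: (poly_cg _ _ _) => [[x r] p'] /le_trans; apply.
rewrite mulr_sumr; apply: ler_sum => k _.
rewrite mulrC ler_wpM2r//; first by rewrite divr_ge0// ltW.
by rewrite -[leLHS]real_normK ?num_real// lerXn2r ?nnegrE ?mulr_ge0 ?exprn_ge0// pq.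
Qed.

(** * Spectral theorem and transfer to vectors *)

Section CoordinateProduct.
Context {R : realType} {I : finType}.
Implicit Types (x y z : {ffun I -> R[i]}) (c : R[i]).

Lemma mul_conj_cabs c : c * (Num.conj c) = (cabs c ^+ 2)%:C.
Proof.
case: c => a b; rewrite /cabs /= sqr_sqrtr ?addr_ge0 ?sqr_ge0//.
by apply/eqP; rewrite eq_complex /=; apply/andP; split; apply/eqP; ring.
Qed.

Lemma cdot_sqnorm x : cdot x x = (sqnorm x)%:C.
Proof.
rewrite /cdot /sqnorm rmorph_sum; apply: eq_bigr => i _.
exact: mul_conj_cabs.
Qed.

Lemma sqnorm_ge0 x : 0 <= sqnorm x.
Proof. by apply: sumr_ge0 => i _; exact: sqr_ge0. Qed.

Lemma sqnorm_eq0 x : (sqnorm x == 0) = (x == 0).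
Proof.
apply/idP/eqP => [|->]; last first.
  by rewrite /sqnorm big1// => i _; rewrite ffunE /cabs Normc.normc0 expr0n.
rewrite psumr_eq0; last by move=> i _; exact: sqr_ge0.
move=> /allP x0; apply/ffunP => i; rewrite ffunE.
apply: Normc.eq0_normc; apply/eqP.
by rewrite -sqrf_eq0; exact: x0 (mem_index_enum i).
Qed.

Lemma sqnorm_gt0 x : (0 < sqnorm x) = (x != 0).
Proof. by rewrite lt_neqAle sqnorm_ge0 andbT eq_sym sqnorm_eq0. Qed.

Lemma conj_cdot x y : Num.conj (cdot x y) = cdot y x.
Proof.
rewrite /cdot rmorph_sum; apply: eq_bigr => i _ /=.
by rewrite rmorphM /= conjCK mulrC.
Qed.

Lemma cdotDl c x y z :
  cdot [ffun i => x i + c * y i] z = cdot x z + c * cdot y z.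
Proof.
rewrite /cdot mulr_sumr -big_split; apply: eq_bigr => i _ /=.
by rewrite ffunE mulrDl mulrA.
Qed.

Lemma cdotBl x y z : cdot (x - y) z = cdot x z - cdot y z.
Proof.
by rewrite /cdot -sumrB; apply: eq_bigr => i _ /=; rewrite !ffunE mulrBl.
Qed.

Lemma cdotZl c x y : cdot [ffun i => c * x i] y = c * cdot x y.
Proof. by rewrite /cdot mulr_sumr; apply: eq_bigr => i _; rewrite ffunE mulrA. Qed.

Lemma cdot0l x : cdot 0 x = 0.
Proof. by rewrite /cdot big1// => i _; rewrite ffunE mul0r. Qed.

Lemma cdot_delta x j : cdot x [ffun i => (i == j)%:R] = x j.
Proof.
rewrite /cdot (bigD1 j)//= ffunE eqxx rmorph1 mulr1 big1 ?addr0// => i ij.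
by rewrite ffunE (negbTE ij) rmorph0 mulr0.
Qed.

End CoordinateProduct.

Section SpectralBasis.
Context {R : realType} {I : finType} (S : {ffun I -> R[i]} -> {ffun I -> R[i]}).

(** Indexing by [I] itself builds in the dimension count, and the type of [mu] makes the eigenvalues
    real. *)
Record spectral_basis (e : I -> {ffun I -> R[i]}) (mu : I -> R) : Prop :=
  SpectralBasis {
  sb_orthonormal : forall j k, cdot (e j) (e k) = (j == k)%:R ;
  sb_eigen : forall k, S (e k) = [ffun i => (mu k)%:C * e k i] ;
  sb_expansion : forall (x : {ffun I -> R[i]}) i, x i = \sum_k cdot x (e k) * e k i }.

Hypothesis S_sym : selfadjoint S.

(** The spectral theorem for Hermitian matrices, transported along an enumeration of [I]; the basis
    vectors are the rows of the unitary matrix. *)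
Lemma spectral_basis_exists : exists e mu, spectral_basis e mu.
Proof.
pose n := #|I|.
pose delta (j : I) : {ffun I -> R[i]} := [ffun i => (i == j)%:R].
pose A : 'M[R[i]]_n := \matrix_(i, j) S (delta (enum_val i)) (enum_val j).
(* Linearity of [S] comes from self-adjointness: [S x j] is the product of [x] with
   [S (delta j)]. *)
have SA x j : S x j = \sum_i x i * S (delta i) j.
  rewrite -(cdot_delta (S x)) S_sym; apply: eq_bigr => i _; congr (_ * _).
  by rewrite -[S _ i]cdot_delta conj_cdot -S_sym cdot_delta.
have hA : A \is hermsymmx.
  apply/is_hermitianmxP; rewrite expr0 scale1r; apply/matrixP => i j.
  by rewrite !mxE -[LHS]cdot_delta S_sym -conj_cdot cdot_delta.
have /orthomx_spectralP := hermitian_normalmx hA.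
have /mxOverP Dreal := hermitian_spectral_diag_real hA.
have := spectral_unitarymx A.
set P := spectralmx A; set D := spectral_diag A in Dreal * => uP AE.
have PV : invmx P = (map_mx Num.conj P^T) by exact: invmx_unitary.
have sumI (F : I -> R[i]) : \sum_k F k = \sum_(k < n) F (enum_val k).
  by rewrite (reindex (@enum_val I I))//; exact/onW_bij/enum_val_bij.
exists (fun k => [ffun i => P (enum_rank k) (enum_rank i)]).
exists (fun k => complex.Re (D 0 (enum_rank k))).
split=> [j k|k|x i].
- rewrite /cdot sumI.
  transitivity ((P *m map_mx Num.conj P^T) (enum_rank j) (enum_rank k)).
    rewrite mxE; apply: eq_bigr => i _.
    by rewrite !ffunE !enum_valK !mxE.
  by rewrite (unitarymxP uP) mxE (inj_eq enum_rank_inj).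
- apply/ffunP => j; rewrite SA sumI !ffunE.
  (* The eigenvector equation is row [k] of [P A = D P]. *)
  transitivity ((P *m A) (enum_rank k) (enum_rank j)).
    by rewrite mxE; apply: eq_bigr => i _; rewrite !ffunE !mxE enum_valK enum_rankK.
  rewrite AE !mulmxA mulmxV ?unitarymx_unit// mul1mx mul_diag_mx mxE.
  by rewrite RRe_real.
under eq_bigr do rewrite ffunE /cdot mulr_suml.
(* Completeness is [P^* P = 1]: only the term of index [i] survives. *)
rewrite exchange_big /= (bigD1 i)//= [X in _ + X]big1 ?addr0.
  under eq_bigr do rewrite -mulrA.
  rewrite -mulr_sumr sumI.
  transitivity (x i * (map_mx Num.conj P^T *m P) (enum_rank i) (enum_rank i)).
    by rewrite -PV mulVmx ?unitarymx_unit// mxE eqxx mulr1.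
  congr (_ * _); rewrite mxE; apply: eq_bigr => k _.
  by rewrite !ffunE !mxE enum_valK.
move=> j ji; under eq_bigr do rewrite -mulrA.
rewrite -mulr_sumr sumI.
transitivity (x j * (map_mx Num.conj P^T *m P) (enum_rank j) (enum_rank i)).
  congr (_ * _); rewrite mxE; apply: eq_bigr => k _.
  by rewrite !ffunE !mxE enum_valK.
by rewrite -PV mulVmx ?unitarymx_unit// mxE (inj_eq enum_rank_inj) (negbTE ji) mulr0.
Qed.

Context (e : I -> {ffun I -> R[i]}) (mu : I -> R) (eb : spectral_basis e mu).
Implicit Types x y : {ffun I -> R[i]}.

Lemma cdot_coord x y : cdot x y = \sum_k cdot x (e k) * Num.conj (cdot y (e k)).
Proof.
rewrite {1}/cdot; under eq_bigr => i _.
  rewrite (sb_expansion eb y i) rmorph_sum mulr_sumr.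
  over.
rewrite exchange_big; apply: eq_bigr => k _ /=.
rewrite /cdot mulr_suml; apply: eq_bigr => i _.
by rewrite rmorphM /=; ring.
Qed.

Lemma cdot_image k x : cdot (S x) (e k) = (mu k)%:C * cdot x (e k).
Proof.
rewrite S_sym (sb_eigen eb) -conj_cdot cdotZl rmorphM /= conj_cdot.
by congr (_ * _); rewrite /Num.conj /= oppr0.
Qed.

Lemma spectral_basis_ext x y :
  (forall k, cdot x (e k) = cdot y (e k)) -> x = y.
Proof.
move=> xy; apply/ffunP => i; rewrite (sb_expansion eb x i) (sb_expansion eb y i).
by apply: eq_bigr => k _; rewrite xy.
Qed.

(** An eigenvector has a nonzero coordinate along some [e k]; comparing this coordinate on both
    sides of the eigenvalue equation gives [mu k]. *)
Lemma is_eigenvalue_spectral (c : R[i]) :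
  is_eigenvalue S c <-> exists k, c = (mu k)%:C.
Proof.
split=> [[x x0 Sx]|[k ->]].
  have [k xk] : exists k, cdot x (e k) != 0.
    apply/not_existsP => xe; case/eqP: x0; apply: spectral_basis_ext => k.
    by rewrite cdot0l; apply/eqP; apply: contra_notT (xe k).
  exists k; apply: (mulIf xk).
  by rewrite -cdot_image Sx cdotZl.
exists (e k); last exact: sb_eigen eb k.
apply/negP => /eqP ek0; have := sb_orthonormal eb k k.
rewrite ek0 cdot_sqnorm eqxx => /esym/eqP.
by rewrite (_ : sqnorm 0 = 0) ?oner_eq0//; apply/eqP; rewrite sqnorm_eq0.
Qed.

End SpectralBasis.

(** * Conjugate gradients read in the eigenbasis *)

Section ConjugateGradients.
Context {R : realType} {I : finType} (S : {ffun I -> R[i]} -> {ffun I -> R[i]}).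
Hypothesis S_sym : selfadjoint S.
Context (e : I -> {ffun I -> R[i]}) (mu : I -> R) (eb : spectral_basis S e mu).
Hypothesis mu_gt0 : forall k, 0 < mu k.
Context (b x : {ffun I -> R[i]}) (Sx : S x = b).

Let beta k : R := cabs (cdot b (e k)) ^+ 2.

(* Read in the eigenbasis: [v = p(S) b]. *)
Definition krylov_vector (p : {poly R}) (v : {ffun I -> R[i]}) :=
  forall k, cdot v (e k) = (p.[mu k])%:C * cdot b (e k).

(** All inner products of the vector recursion are thus real moments, so its coefficients are those
    of the polynomial recursion. *)
Lemma cdot_krylov p q v w : krylov_vector p v -> krylov_vector q w ->
  cdot v w = (moment mu beta (p * q))%:C.
Proof.
move=> pv qw; rewrite (cdot_coord eb) rmorph_sum; apply: eq_bigr => k _ /=.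
rewrite rmorphM /= -mul_conj_cabs pv qw hornerM !rmorphM /=.
by rewrite conj_Creal ?complex_real//; ring.
Qed.

Lemma krylov_vectorD p q v w (c : R) : krylov_vector p v -> krylov_vector q w ->
  krylov_vector (p + c *: q) [ffun i => v i + c%:C * w i].
Proof.
move=> pv qw k; rewrite cdotDl pv qw hornerD hornerZ rmorphD rmorphM /=.
by rewrite mulrDl mulrA.
Qed.

Lemma krylov_vectorX p v : krylov_vector p v -> krylov_vector ('X * p) (S v).
Proof.
move=> pv k; rewrite (cdot_image S_sym eb) pv hornerM hornerX rmorphM /=.
by rewrite mulrA.
Qed.

Definition cg_run m := iter m (cg_step S) (CGState 0 b b).

Lemma cg_krylov m :
  let: (x, r, p) := poly_cg mu beta m in
  [/\ krylov_vector x (cg_u (cg_run m)), krylov_vector r (cg_r (cg_run m)) &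
      krylov_vector p (cg_p (cg_run m))].
Proof.
elim: m => [|m].
  by split=> k /=; rewrite ?horner0 ?hornerC ?mul1r// cdot0l mul0r.
rewrite /cg_run /poly_cg !iterS -/(cg_run m).
case: (iter m (poly_cg_step mu beta) (0, 1, 1)) => [[X1 r1] p1].
case: (cg_run m) => v rs p [/= Xv rr pp].
(* The stopping tests agree, so both recursions freeze at the same step. *)
have rr0 : (rs == 0) = (moment mu beta (r1 * r1) == 0).
  rewrite -sqnorm_eq0 -(inj_eq (@complexI R)) -cdot_sqnorm.
  by rewrite (cdot_krylov rr rr) (inj_eq (@complexI R)).
rewrite rr0; case: ifP => // _.
rewrite !(cdot_krylov rr rr) (cdot_krylov pp (krylov_vectorX pp)).
rewrite mulrCA -fmorph_div /=.
set th := moment _ _ _ / _.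
have r'E : [ffun i => rs i - th%:C * S p i] = [ffun i => rs i + (- th)%:C * S p i].
  by apply/ffunP => i; rewrite !ffunE rmorphN mulNr.
have rr' : krylov_vector (r1 - th *: ('X * p1)) [ffun i => rs i - th%:C * S p i].
  by rewrite r'E -scaleNr; exact: krylov_vectorD (krylov_vectorX _).
split=> //; first exact: krylov_vectorD.
by rewrite (cdot_krylov rr' rr') -fmorph_div; exact: krylov_vectorD.
Qed.

(** Along [e k] the solution is [b] divided by [mu k], and [r = 1 - 'X * y] turns the error into [-
    r.[mu k] / mu k] times the coordinate of [b]. The energy weights its square by [mu k], which
    leaves [beta k / mu k]. *)
Lemma cg_energy m :
  let: (_, r, _) := poly_cg mu beta m in
  energy_norm S (cg_iterate S b m - x) =
  Num.sqrt (\sum_k beta k / mu k * r.[mu k] ^+ 2).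
Proof.
have := cg_krylov m; have := poly_cg_residual mu beta m.
case: (poly_cg mu beta m) => [[y r] p] rE [yu _ _]; rewrite /energy_norm.
congr Num.sqrt; rewrite (cdot_coord eb) -[RHS]/(complex.Re (_%:C)).
congr complex.Re; rewrite rmorph_sum; apply: eq_bigr => k _.
have muk : (mu k)%:C != 0 by rewrite (inj_eq (@complexI R)) gt_eqF.
have dE : cdot (cg_iterate S b m - x) (e k) =
    (- (r.[mu k] / mu k))%:C * cdot b (e k).
  rewrite cdotBl [cdot (cg_iterate _ _ _) _]yu -Sx (cdot_image S_sym eb) !mulrA.
  rewrite -[X in _ - X]mul1r -mulrBl; congr (_ * _).
  rewrite -!rmorphM -(rmorph1 (real_complex R)) -rmorphB; congr (_%:C).
  rewrite rE hornerD hornerN hornerM hornerC hornerX; field.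
  by rewrite gt_eqF.
rewrite (cdot_image S_sym eb) dE rmorphM /= conj_Creal ?complex_real//.
transitivity ((mu k * (r.[mu k] / mu k) ^+ 2)%:C *
    (cdot b (e k) * Num.conj (cdot b (e k)))).
  by rewrite !rmorphM /= rmorphN; ring.
rewrite mul_conj_cabs -rmorphM; congr (_%:C); rewrite -/(beta k).
by field; rewrite gt_eqF.
Qed.

Lemma cg_chebyshev_bound (l h : R) m : 0 < l -> l <= h ->
  (forall k, l <= mu k <= h) ->
  energy_norm S (cg_iterate S b m - x) <=
  2 * ((Num.sqrt (h / l) - 1) / (Num.sqrt (h / l) + 1)) ^+ m *
    energy_norm S (cg_iterate S b 0 - x).
Proof.
move=> l0 lh lmuh.
have beta0 k : 0 <= beta k by exact: sqr_ge0.
have -> : energy_norm S (cg_iterate S b 0 - x) =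
    Num.sqrt (\sum_k beta k / mu k).
  rewrite (cg_energy 0); congr Num.sqrt; apply: eq_bigr => k _.
  by rewrite hornerC expr1n mulr1.
have := poly_cg_chebyshev m l0 lh lmuh beta0; have := cg_energy m.
case: (poly_cg mu beta m) => [[_ r] _] -> H.
have [q0 _] := chebyshev_residual m l0 lh.
apply: (le_trans (ler_wsqrtr H)).
by rewrite sqrtrM ?sqr_ge0// sqrtr_sqr ger0_norm// mulr_ge0// exprn_ge0.
Qed.

End ConjugateGradients.

(** * Condition number and error bound from frame bounds *)

Section Stability.
Context {R : realType} {I I' : finType} (T : {ffun I -> R[i]} -> {ffun I' -> R[i]}).
Hypothesis T_linear : linear_map T.

Lemma gram_selfadjoint : selfadjoint (gram T).
Proof.
move=> x y; rewrite -(adjP T_linear).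
by rewrite -conj_cdot -(adjP T_linear) conj_cdot.
Qed.

Lemma cdot_gram x : cdot (gram T x) x = (sqnorm (T x))%:C.
Proof. by rewrite gram_selfadjoint -(adjP T_linear) cdot_sqnorm. Qed.

(** On unit eigenvectors the frame bounds read [1 - eps <= mu k <= 1 + eps], as [mu k] is the
    squared norm of [T (e k)]. *)
Lemma frame_well_conditioned (eps : R) : eps < 1 ->
  (forall z, frame_bounds T eps z) -> well_conditioned T eps.
Proof.
move=> eps1 Tframe; have T_sym := gram_selfadjoint.
have [e [mu eb]] := spectral_basis_exists T_sym.
have e1 k : sqnorm (e k) = 1.
  by apply: (@complexI R); rewrite -cdot_sqnorm (sb_orthonormal eb) eqxx.
have muE k : mu k = sqnorm (T (e k)).
  apply: (@complexI R); rewrite -cdot_gram (cdot_image T_sym eb).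
  by rewrite (sb_orthonormal eb) eqxx mulr1.
have mu_bnd k : 1 - eps <= mu k <= 1 + eps.
  by have := Tframe (e k); rewrite /frame_bounds e1 !mulr1 -muE.
have mu0 k : 0 < mu k.
  by case/andP: (mu_bnd k) => + _; apply: lt_le_trans; rewrite subr_gt0.
split=> //.
  move=> x x0; rewrite cdot_gram ltcR; have := Tframe x => /andP[+ _].
  by apply: lt_le_trans; rewrite mulr_gt0 ?subr_gt0// sqnorm_gt0.
move=> /card_gt0P[i0 _].
case: (@Order.TotalTheory.arg_minP _ R I i0 xpredT mu isT) => kmin _ kminP.
case: (@Order.TotalTheory.arg_maxP _ R I i0 xpredT mu isT) => kmax _ kmaxP.
exists (mu kmin), (mu kmax); split.
- split; first by apply/(is_eigenvalue_spectral T_sym eb); exists kmin.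
  by move=> c /(is_eigenvalue_spectral T_sym eb)[k ->]; rewrite lecR kminP.
- split; first by apply/(is_eigenvalue_spectral T_sym eb); exists kmax.
  by move=> c /(is_eigenvalue_spectral T_sym eb)[k ->]; rewrite lecR; exact: kmaxP.
- rewrite ler_pdivrMr// mulrAC ler_pdivlMr ?subr_gt0//.
  have [/andP[l1 l2] /andP[h1 h2]] := (mu_bnd kmin, mu_bnd kmax).
  have e0 : 0 <= 1 + eps by exact: le_trans (ltW (mu0 kmax)) h2.
  by apply: ler_pM => //; rewrite ?ltW// subr_gt0.
move=> c x m Sx; apply: (cg_chebyshev_bound T_sym eb mu0 Sx) => //.
  exact: kminP.
by move=> k; rewrite kminP//=; exact: kmaxP.
Qed.

End Stability.

(** * Parseval's identity *)

Section ComplexIntegral.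
Context {R : realType} {disp : measure_display} {T : measurableType disp}.
Context (mu : {measure set T -> \bar R}).
Implicit Types (f g : T -> R[i]) (c : R[i]).
Local Notation Re := complex.Re.
Local Notation Im := complex.Im.

Lemma in_L1_cabs_bound f (h : T -> R) :
  measurable_fun [set: T] (fun x => Re (f x)) ->
  measurable_fun [set: T] (fun x => Im (f x)) ->
  (forall x, cabs (f x) <= h x) -> mu.-integrable [set: T] (EFin \o h) ->
  in_L1 mu f.
Proof.
move=> mRe mIm fh ih.
have hn x : `|Re (f x)| <= `|h x| /\ `|Im (f x)| <= `|h x|.
  have fhx : cabs (f x) <= `|h x| by rewrite (le_trans (fh x))// ler_norm.
  by split; apply: le_trans fhx; case: (f x) => p q; rewrite /cabs /= -sqrtr_sqr;
    rewrite ler_wsqrtr// (lerDl, lerDr) sqr_ge0.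
split; apply: (le_integrable measurableT _ _ ih).
- exact/measurable_EFinP.
- by move=> x _ /=; rewrite lee_fin; case: (hn x).
- exact/measurable_EFinP.
- by move=> x _ /=; rewrite lee_fin; case: (hn x).
Qed.

Lemma cabsM c c' : cabs (c * c') = cabs c * cabs c'.
Proof. exact: Normc.normcM. Qed.

Lemma cabs_conj c : cabs (Num.conj c) = cabs c.
Proof. by case: c => p q; rewrite /cabs /= sqrrN. Qed.

Lemma cabs_ge0 c : 0 <= cabs c.
Proof. by case: c => p q; exact: sqrtr_ge0. Qed.

Lemma cabs_sqr c : cabs c ^+ 2 = Re c ^+ 2 + Im c ^+ 2.
Proof. by case: c => p q; rewrite /cabs /= sqr_sqrtr// addr_ge0 ?sqr_ge0. Qed.

Lemma in_L2_integrable f : in_L2 mu f ->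
  mu.-integrable [set: T] (EFin \o (fun x => cabs (f x) ^+ 2)).
Proof.
case=> mRe mIm foo; apply/integrableP; split.
  apply/measurable_EFinP; rewrite (_ : (fun _ => _) =
      (fun x => Re (f x) ^+ 2 + Im (f x) ^+ 2)).
    by apply: measurable_funD; exact: measurable_funX.
  by apply/funext => x; rewrite cabs_sqr.
apply: le_lt_trans foo; rewrite le_eqVlt; apply/orP; left; apply/eqP.
by apply: eq_integral => x _ /=; rewrite ger0_norm// sqr_ge0.
Qed.

Lemma in_L2_mul_conj f g : in_L2 mu f -> in_L2 mu g ->
  in_L1 mu (fun x => f x * Num.conj (g x)).
Proof.
move=> f2 g2; have [fR fI _] := f2; have [gR gI _] := g2.
apply: (@in_L1_cabs_bound _ (fun x => cabs (f x) ^+ 2 + cabs (g x) ^+ 2)).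
- rewrite (_ : (fun _ => _) = (fun x => Re (f x) * Re (g x) + Im (f x) * Im (g x))).
    by apply: measurable_funD; exact: measurable_funM.
  by apply/funext => x; case: (f x) (g x) => [p q] [s t] /=; ring.
- rewrite (_ : (fun _ => _) = (fun x => Im (f x) * Re (g x) - Re (f x) * Im (g x))).
    by apply: measurable_funB; exact: measurable_funM.
  by apply/funext => x; case: (f x) (g x) => [p q] [s t] /=; ring.
- move=> x; rewrite cabsM cabs_conj; have := cabs_ge0 (f x); have := cabs_ge0 (g x).
  nra.
exact: (integrableD measurableT (in_L2_integrable f2) (in_L2_integrable g2)).
Qed.

Lemma cintegral_lin c f g : in_L1 mu f -> in_L1 mu g ->
  in_L1 mu (fun x => c * f x + g x) /\
  cintegral mu (fun x => c * f x + g x) = c * cintegral mu f + cintegral mu g.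
Proof.
case: c => p q [fR fI] [gR gI].
have ReE x : Re ((p +i* q) * f x + g x) = p * Re (f x) + (- q * Im (f x) + Re (g x)).
  by case: (f x) (g x) => [a b] [a' b'] /=; ring.
have ImE x : Im ((p +i* q) * f x + g x) = p * Im (f x) + (q * Re (f x) + Im (g x)).
  by case: (f x) (g x) => [a b] [a' b'] /=; ring.
have iZ k (h : T -> R) : mu.-integrable [set: T] (EFin \o h) ->
    mu.-integrable [set: T] (EFin \o (fun x => k * h x)).
  by move=> ih; exact: (integrableZl measurableT k ih).
have iD (h h' : T -> R) : mu.-integrable [set: T] (EFin \o h) ->
    mu.-integrable [set: T] (EFin \o h') ->
    mu.-integrable [set: T] (EFin \o (fun x => h x + h' x)).
  by move=> ih ih'; exact: (integrableD measurableT ih ih').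
split.
  split; rewrite -/(EFin \o (fun x => _)).
    by rewrite (funext ReE); apply: (iD _ _ _ (iD _ _ _ _)) => //; exact: iZ.
  by rewrite (funext ImE); apply: (iD _ _ _ (iD _ _ _ _)) => //; exact: iZ.
rewrite /cintegral (funext ReE) (funext ImE).
rewrite !RintegralD ?RintegralZl//; try by [exact: iZ | apply: (iD _ _) => //; exact: iZ].
apply/eqP; rewrite eq_complex /=; apply/andP.
by split; apply/eqP; ring.
Qed.

Lemma cintegral_sum (J : Type) (s : seq J) (c : J -> R[i]) (F : J -> T -> R[i]) :
  (forall j, in_L1 mu (F j)) ->
  in_L1 mu (fun x => \sum_(j <- s) c j * F j x) /\
  cintegral mu (fun x => \sum_(j <- s) c j * F j x) =
  \sum_(j <- s) c j * cintegral mu (F j).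
Proof.
move=> F1; elim: s => [|j s [IH1 IH2]].
  under eq_fun do rewrite big_nil.
  rewrite big_nil; split; first by split; exact: integrable0.
  by rewrite /cintegral !Rintegral_cst//= !mul0r.
under eq_fun do rewrite big_cons.
by rewrite big_cons -IH2; exact: cintegral_lin.
Qed.

End ComplexIntegral.

(** The squared modulus expands into a finite sum over pairs of indices, of which orthonormality
    keeps the diagonal. *)
Lemma parseval {R : realType} {d : nat} (M : compact_riemannian R d)
    (mu : probability (borel M) R) (u : nat -> M -> R[i]) (lam : nat -> R)
    (s : seq nat) (z : nat -> R[i]) :
  eigenbasis mu u lam -> uniq s ->
  \int[mu]_x (cabs (\sum_(l <- s) z l * u l x) ^+ 2) =
  \sum_(l <- s) cabs (z l) ^+ 2.
Proof.
move=> hu us; apply: (@complexI R).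
pose c (p : nat * nat) := z p.1 * Num.conj (z p.2).
pose F (p : nat * nat) (x : borel M) := u p.1 x * Num.conj (u p.2 x).
have F1 p : in_L1 mu (F p) by apply: in_L2_mul_conj; exact: (eb_L2 hu).
have PE x : (cabs (\sum_(l <- s) z l * u l x) ^+ 2)%:C =
    \sum_(p <- [seq (k, l) | k <- s, l <- s]) c p * F p x.
  rewrite -mul_conj_cabs rmorph_sum mulr_suml big_allpairs_dep /=.
  apply: eq_bigr => k _; rewrite mulr_sumr; apply: eq_bigr => l _.
  by rewrite rmorphM /c /F /=; ring.
have FE k l : cintegral mu (F (k, l)) = (k == l)%:R := eb_orthonormal hu k l.
have [_] := cintegral_sum [seq (k, l) | k <- s, l <- s] c F1.
rewrite -(funext PE) [X in X = _ -> _]/cintegral /=.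
rewrite Rintegral_cst//= mul0r => E; apply: (etrans E).
rewrite big_allpairs_dep /= rmorph_sum big_seq [RHS]big_seq.
apply: eq_bigr => k ks; rewrite (bigD1_seq k)//= FE eqxx mulr1.
rewrite /c mul_conj_cabs /= big1 ?addr0// => l lk.
by rewrite FE eq_sym (negbTE lk) mulr0.
Qed.

(** * Frame bounds of the analysis operator *)

Lemma big_seq_sub (V : nmodType) (T : choiceType) (s : seq T) (F : T -> V) :
  uniq s -> \sum_(x : seq_sub s) F (val x) = \sum_(x <- s) F x.
Proof.
move=> us; rewrite -(big_map val xpredT F); apply: perm_big; apply: uniq_perm => //.
  by rewrite map_inj_uniq; [exact: index_enum_uniq | exact: val_inj].
move=> x; apply/mapP/idP => [[y _ ->]|xs]; first exact: valP.
by exists (SeqSub xs) => //; exact: mem_index_enum.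
Qed.

Lemma big_fset_widen (V : nmodType) (T : choiceType) (A B : {fset T}) (F : T -> V) :
  {subset A <= B} -> (forall l, l \notin A -> F l = 0) ->
  \sum_(l <- A) F l = \sum_(l <- B) F l.
Proof.
move=> AB F0; rewrite [RHS](bigID (mem A))/= [X in _ = _ + X]big1 ?addr0//.
rewrite -[RHS]big_filter; apply: perm_big; apply: uniq_perm.
- exact: fset_uniq.
- by rewrite filter_uniq// fset_uniq.
by move=> l; rewrite mem_filter andb_idr//; exact: AB.
Qed.

Section ActiveSet.
Context {R : realType} {d : nat} (M : compact_riemannian R d).
Context (mu : probability (borel M) R) (u : nat -> M -> R[i]) (lam : nat -> R).
Hypothesis hu : eigenbasis mu u lam.
Context (alpha : R -> R[i]).
Hypothesis alpha_supp : supp_in_unit (fourier alpha).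

Lemma lam_ge0 l : 0 <= lam l.
Proof.
elim: l => [|l IH]; first by rewrite (eb_lam0 hu).
exact: le_trans IH (eb_lam_le hu l).
Qed.

Lemma active_lam_le j l : fourier alpha (lam l / 2 ^+ j) != 0 -> lam l <= 2 ^+ j.
Proof.
move=> al0; have p2 : 0 < 2 ^+ j :> R by rewrite exprn_gt0.
have /alpha_supp : (closure [set xi | fourier alpha xi != 0] `&` `[0, +oo[)
    (lam l / 2 ^+ j).
  split; first exact: subset_closure.
  by rewrite /= in_itv /= andbT divr_ge0 ?lam_ge0// ltW.
by rewrite /= in_itv /= => /andP[_]; rewrite ler_pdivrMr// mul1r.
Qed.

(** On an infinite set [fset_set] returns the empty set, so finiteness must be shown: active indices
    satisfy [lam l <= 2 ^+ j], and [lam] tends to infinity. *)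
Lemma mem_active j l :
  (l \in active alpha lam j) = (fourier alpha (lam l / 2 ^+ j) != 0).
Proof.
rewrite in_fset_set; first by apply/idP/idP => [/set_mem|al0]; [|exact: mem_set].
have /cvgryPgt/(_ (2 ^+ j))[N _ HN] := eb_lam_oo hu.
apply: (@sub_finite_set _ _ `I_N); last exact: finite_II.
move=> i /= /active_lam_le li; rewrite ltnNge; apply/negP => /HN /=.
by rewrite ltNge li.
Qed.

Lemma diffusion_poly_active j (v : nat -> R[i]) :
  diffusion_poly u lam (2 ^+ j)
    (fun x => \sum_(l <- active alpha lam j) v l * u l x).
Proof.
set A := active alpha lam j.
exists (\max_(l <- A) l).+1, (fun l => if l \in A then v l else 0); split.
  move=> l; case: ifP => [|_ /eqP//]; rewrite mem_active => lA _.
  exact: active_lam_le.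
apply/funext => x.
rewrite -(big_mkord xpredT (fun l => (if l \in A then v l else 0) * u l x)).
under [RHS]eq_bigr do rewrite (fun_if (fun c => c * _)) mul0r.
rewrite -big_mkcond -big_filter; apply: perm_big; apply: uniq_perm.
- exact: fset_uniq.
- by rewrite filter_uniq// iota_uniq.
move=> l; rewrite mem_filter mem_index_iota /= andb_idr// => lA.
by rewrite ltnS (big_rem l)//= leq_maxl.
Qed.

End ActiveSet.

(** * Telescoping of the spectral energies *)

Section AnalysisFrame.
Context {R : realType} {d : nat} (M : compact_riemannian R d).
Context (mu : probability (borel M) R) (u : nat -> M -> R[i]) (lam : nat -> R).
Hypothesis hu : eigenbasis mu u lam.
Context (alpha : R -> R[i]).
Hypothesis alpha_supp : supp_in_unit (fourier alpha).

(** The common interface of both node families, for a single level. In case (ii) it is used with the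
    polynomials of level [j] and the nodes of level [j + s]. *)
Definition MZ_level (eps : R) (j : nat) (X : seq M) (w : M -> R) :=
  [/\ uniq X, (forall x, x \in X -> 0 <= w x) &
    forall P, diffusion_poly u lam (2 ^+ j) P ->
    (1 - eps) * \int[mu]_x (cabs (P x) ^+ 2)
      <= \sum_(x <- X) w x * cabs (P x) ^+ 2
      <= (1 + eps) * \int[mu]_x (cabs (P x) ^+ 2)].

Context (eps : R) (X : nat -> seq M) (w : nat -> M -> R).

(** With [Num.sqrt (w j x)] factored out, the squared norm of the samples is the quadrature sum of
    [|P|^2], whose integral is [E] by Parseval. *)
Lemma synth_bounds j (v : nat -> R[i]) : MZ_level eps j (X j) (w j) ->
  let E := \sum_(l <- active alpha lam j) cabs (v l) ^+ 2 in
  (1 - eps) * E <=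
    sqnorm (synth u X w [ffun l : active alpha lam j => v (val l)])
    <= (1 + eps) * E.
Proof.
case=> uX w0 /(_ _ (diffusion_poly_active hu alpha_supp j v)).
rewrite (parseval _ hu (fset_uniq _)).
rewrite (_ : \sum_(x <- X j) _ =
  sqnorm (synth u X w [ffun l : active alpha lam j => v (val l)]))//.
rewrite -big_seq_sub//; apply: eq_bigr => x _; rewrite ffunE.
rewrite (_ : \sum_l _ = (Num.sqrt (w j (val x)))%:C *
    \sum_(l <- active alpha lam j) v l * u l (val x)).
  rewrite cabsM exprMn; congr (_ * _).
  rewrite /cabs /= expr0n addr0 sqrtr_sqr ger0_norm ?sqrtr_ge0//.
  by rewrite sqr_sqrtr// w0// (valP x).
rewrite big_seq_fsetE mulr_sumr; apply: eq_bigr => l _.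
by rewrite ffunE; ring.
Qed.

Context {r : nat} (a : int -> R[i]) (b : 'I_r -> int -> R[i]) (J K : nat).
Hypothesis hJK : (J < K)%N.
Hypothesis active_sub : forall j, (J < j)%N ->
  {subset active alpha lam j.-1 <= active alpha lam j}.
Hypothesis refinement : forall xi : R,
  fourier alpha (2 * xi) = symbol a xi * fourier alpha xi.
Hypothesis unity : forall j l : nat, (J < j <= K)%N -> l \in active alpha lam j ->
  cabs (symbol a (lam l / 2 ^+ j)) ^+ 2
    + \sum_(k < r) cabs (symbol (b k) (lam l / 2 ^+ j)) ^+ 2 = 1.

Let energy (z : coef lam alpha K) j : R :=
  \sum_(l <- active alpha lam j) cabs (vlevel a z j l) ^+ 2.

Let band (z : coef lam alpha K) j k (l : nat) : R[i] :=
  vlevel a z j l * (symbol (b k) (lam l / 2 ^+ j))^*.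

Let band_energy (z : coef lam alpha K) j k : R :=
  \sum_(l <- active alpha lam j) cabs (band z j k l) ^+ 2.

(** This is the partition of unity multiplied by the squared modulus of the level [j.+1] coefficient
    and summed over its active set. *)
Lemma energy_level z j : (J <= j < K)%N ->
  energy z j.+1 - energy z j = \sum_(k < r) band_energy z j.+1 k.
Proof.
move=> /andP[Jj jK].
have sub l : l \in active alpha lam j -> l \in active alpha lam j.+1.
  exact: (@active_sub j.+1).
have vE l : vlevel a z j l = if l \in active alpha lam j then
    vlevel a z j.+1 l * (symbol a (lam l / 2 ^+ j.+1))^* else 0.
  (* The recursion [vhat] counts steps down from [K], so level [j] comes one step after level
     [j.+1]. *)
  rewrite /vlevel -(subnSK jK) /=.
  by rewrite (subnSK jK) subKn 1?ltnW// subKn.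
have -> : energy z j = \sum_(l <- active alpha lam j.+1)
    cabs (vlevel a z j.+1 l) ^+ 2 * cabs (symbol a (lam l / 2 ^+ j.+1)) ^+ 2.
  transitivity (\sum_(l <- active alpha lam j.+1) cabs (vlevel a z j l) ^+ 2).
    apply: (big_fset_widen sub) => l /negbTE lj.
    by rewrite vE lj /cabs Normc.normc0 expr0n.
  rewrite !big_seq; apply: eq_bigr => l lj1; rewrite vE; case: ifPn => lj.
    by rewrite cabsM cabs_conj exprMn.
  (* At [xi = lam l / 2 ^+ j.+1] the refinement relation reads [0 = symbol a xi * fourier alpha xi]
     with a nonzero second factor: truncation to the smaller active set loses no energy. *)
  have -> : symbol a (lam l / 2 ^+ j.+1) = 0.
    move: lj; rewrite (mem_active hu alpha_supp j) negbK => /eqP lj.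
    move: lj1; rewrite (mem_active hu alpha_supp j.+1) => lj1.
    apply/eqP; have := refinement (lam l / 2 ^+ j.+1).
    rewrite (_ : 2 * _ = lam l / 2 ^+ j); last by rewrite exprS; field.
    by rewrite lj => /esym/eqP; rewrite mulf_eq0 (negbTE lj1) orbF.
  by rewrite /cabs Normc.normc0 expr0n mulr0.
rewrite /energy -sumrB exchange_big big_seq [RHS]big_seq.
apply: eq_bigr => l lj1.
under [RHS]eq_bigr do rewrite cabsM cabs_conj exprMn.
rewrite -mulr_sumr -[X in X - _]mulr1 -mulrBr; congr (_ * _).
by apply/eqP; rewrite subr_eq addrC; apply/eqP/esym/unity; rewrite // ltnS Jj.
Qed.

Lemma energy_top z : energy z K = sqnorm z.
Proof.
rewrite /energy /sqnorm big_seq_fsetE; apply: eq_bigr => l _.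
by rewrite /vlevel subnn /= valK.
Qed.

Lemma energy_sum z : energy z J +
  \sum_(i < K - J) \sum_(k < r) band_energy z (J + i.+1) k = sqnorm z.
Proof.
rewrite -energy_top; apply/eqP; rewrite addrC eq_sym -subr_eq; apply/eqP.
rewrite -(telescope_sumr _ (ltnW hJK)) -{1}[J]add0n big_addn big_mkord.
apply: eq_bigr => i _; rewrite addnS [(J + i)%N]addnC energy_level//.
by rewrite leq_addl /= addnC -ltn_subRL.
Qed.

Lemma sqnorm_analysis z : sqnorm (analysis u lam alpha a b X w J K z) =
  sqnorm (synth u X w [ffun l : active alpha lam J => vlevel a z J (val l)]) +
  \sum_(i < K - J) \sum_(k < r)
    sqnorm (synth u X w
      [ffun l : active alpha lam (J + i.+1) => band z (J + i.+1) k (val l)]).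
Proof.
rewrite {1}/sqnorm big_sumType; congr (_ + _).
  by apply: eq_bigr => x _; rewrite ffunE.
under [RHS]eq_bigr do rewrite pair_big /=.
rewrite sig_big_dep /=; apply: eq_bigr => -[i [k x]] _ /=.
by rewrite ffunE.
Qed.

(** Each block of the output satisfies the bounds of its own level with the same [eps]; these add
    up, and [energy_sum] identifies the total. *)
Lemma analysis_frame_bounds :
  (forall j, (J <= j <= K)%N -> MZ_level eps j (X j) (w j)) ->
  forall z, frame_bounds (analysis u lam alpha a b X w J K) eps z.
Proof.
move=> MZ z; rewrite /frame_bounds sqnorm_analysis -energy_sum.
have /MZ MZJ : (J <= J <= K)%N by rewrite leqnn ltnW.
have /= /andP[lJ uJ] := synth_bounds (vlevel a z J) MZJ.
have MZS (i : 'I_(K - J)) : MZ_level eps (J + i.+1) (X (J + i.+1)%N) (w (J + i.+1)%N).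
  by apply: MZ; rewrite leq_addr /= -leq_subRL ?(ltnW hJK).
have := fun (i : 'I_(K - J)) k => synth_bounds (band z (J + i.+1) k) (MZS i).
move=> /= HB; rewrite !mulrDr; apply/andP; split; apply: lerD.
- exact: lJ.
- rewrite mulr_sumr; apply: ler_sum => i _; rewrite mulr_sumr; apply: ler_sum => k _.
  by case/andP: (HB i k).
- exact: uJ.
rewrite mulr_sumr; apply: ler_sum => i _; rewrite mulr_sumr; apply: ler_sum => k _.
by case/andP: (HB i k).
Qed.

End AnalysisFrame.

(** * Voronoi partitions *)

Lemma seq_argmin {disp : Order.disp_t} {V : orderType disp} (T : eqType)
    (s : seq T) (f : T -> V) : (0 < size s)%N ->
  exists2 x, x \in s & forall x', x' \in s -> (f x <= f x')%O.
Proof.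
elim: s => // x [|y s] IH _.
  by exists x; rewrite ?mem_head// => x'; rewrite inE => /eqP->.
have [//|z zs zmin] := IH.
have [xz|zx] := leP (f x) (f z).
  exists x; first exact: mem_head.
  by move=> x'; rewrite inE => /predU1P[->//|/zmin]; exact: le_trans.
exists z; first by rewrite inE zs orbT.
by move=> x'; rewrite inE => /predU1P[->|/zmin//]; exact: ltW.
Qed.

Section VoronoiQuadrature.
Context {R : realType} {d : nat} (M : compact_riemannian R d).

Lemma geodist_ge0 (x y : M) : (0 <= geodist x y)%E.
Proof.
apply: le_ereal_inf_tmp => L; elim=> // i c L' _ L0 _ _.
by rewrite adde_ge0//; apply: integral_ge0 => t _; rewrite lee_fin sqrtr_ge0.
Qed.

Lemma geodistxx (x : M) : geodist x x = 0%E.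
Proof.
apply/eqP; rewrite eq_le geodist_ge0 andbT.
by apply: ereal_inf_lbound; exact: path_nil.
Qed.

(** Of all nearest nodes the one of least index is taken; its minimality gives the strict inequality
    against earlier nodes. *)
Lemma voronoi_cover (X : seq M) (y : M) : (0 < size X)%N ->
  exists2 x, x \in X & voronoi X x y.
Proof.
move=> X0; have [x xX xmin] := seq_argmin (fun x => geodist x y) X0.
pose P i := (i < size X)%N &&
  all (fun x' => (geodist (nth x X i) y <= geodist x' y)%E) X.
have exP : exists i, P i.
  exists (index x X); rewrite /P index_mem xX nth_index//.
  by apply/allP => x' /xmin.
case: (ex_minnP exP) => i /andP[iX /allP imin] ifirst.
exists (nth x X i); first exact: mem_nth.
move=> x' x'X; split; first exact: imin.
move=> x'i; rewrite ltNge; apply/negP => le.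
have : (i <= index x' X)%N.
  apply: ifirst; rewrite /P index_mem x'X nth_index//; apply/allP => z /imin.
  exact: le_trans.
by rewrite leqNgt (leq_trans x'i)// index_nth.
Qed.

(** Of two such nodes, the earlier one is nearest, yet the later one would have to be strictly
    nearer. *)
Lemma voronoi_disjoint (X : seq M) (x x' y : M) : x \in X -> x' \in X ->
  voronoi X x y -> voronoi X x' y -> x = x'.
Proof.
move=> xX x'X xy x'y; have [[xx' xlt] [x'x x'lt]] := (xy _ x'X, x'y _ xX).
have [lt|lt|] := ltngtP (index x X) (index x' X).
- by have := x'lt lt; rewrite ltNge xx'.
- by have := xlt lt; rewrite ltNge x'x.
by move=> ixx'; rewrite -(nth_index x xX) ixx' nth_index.
Qed.

(** Strictness against earlier nodes comes from the separation, which spares a proof that [geodist]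
    is definite. *)
Lemma voronoi_self (X : seq M) (x : M) : (0 < separation X)%E -> x \in X ->
  voronoi X x x.
Proof.
move=> sep0 xX x' x'X; rewrite geodistxx; split; first exact: geodist_ge0.
move=> x'x; apply: lt_le_trans sep0 _; apply: ereal_inf_lbound.
exists (x', x) => //; split=> //=; apply: contraTneq x'x => ->.
by rewrite ltnn.
Qed.

Lemma voronoi_cball (X : seq M) (x : M) :
  voronoi X x `<=` cball x (fill_distance X).
Proof.
move=> y xy; rewrite /cball /=.
apply: (@le_trans _ _ (\big[mine/+oo]_(x <- X) geodist x y)%E); last first.
  by apply: ereal_sup_ubound; exists y.
rewrite big_seq; elim/big_ind: _ => [|p q xp xq|x' /xy[]//].
- by rewrite leey.
- by rewrite le_min xp.
Qed.

Context (mu : probability (borel M) R) (u : nat -> M -> R[i]) (lam : nat -> R).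

(** Filbir-Mhaskar applies with [n = 2 ^ j] and [kappa = 1], since [gamma / 2 ^+ (j + s)] lies
    between fill distance and separation. Its mesh condition holds because
    [2 ^+ j * (gamma / 2 ^+ (j + s))] equals [c * rho / 2]; this explains [2 * gamma / c] in
    [rho]. *)
Lemma voronoi_MZ_level (c C1 C2 gamma : R) (X : nat -> seq M)
    (w : nat -> M -> R) (s j : nat) :
  filbir_mhaskar mu u lam 1 2 c -> 0 < C1 -> 0 < gamma ->
  nested_voronoi mu C1 C2 gamma X w ->
  let rho := 2 * gamma / c * 2 ^- s in
  rho < 1 -> MZ_level mu u lam rho j (X (j + s)%N) (w (j + s)%N).
Proof.
move=> [c0 FM] C10 g0 [uX _ fX sX cX bX wX] rho rho1.
have rho0 : 0 < rho by rewrite !mulr_gt0 ?invr_gt0 ?exprn_gt0.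
set n := (j + s)%N; have Rn0 : 0 < gamma / 2 ^+ n by rewrite divr_gt0 ?exprn_gt0.
(* The lower cardinality bound excludes an empty node set, whose cells could not cover. *)
have X0 : (0 < size (X n))%N.
  rewrite -(ltr_nat R); case/andP: (cX n) => + _; apply: lt_le_trans.
  by rewrite mulr_gt0// invr_gt0 exprn_gt0.
split; first exact: uX.
  by move=> x xX; rewrite wX// fine_ge0.
move=> P PP.
have fill : ((2 ^ j)%N%:R%:E * fill_distance (X n) <= (c * rho / 2)%:E)%E.
  apply: (@le_trans _ _ ((2 ^ j)%N%:R%:E * (gamma / 2 ^+ n)%:E)%E).
    by rewrite lee_wpmul2l// lee_fin.
  rewrite -EFinM lee_fin natrX /rho /n exprD le_eqVlt; apply/orP; left; apply/eqP.
  by field; rewrite !expf_neq0 ?gt_eqF.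
have sep0 : (0 < separation (X n))%E by rewrite (lt_le_trans _ (sX n))// lte_fin.
have := FM rho (2 ^ j)%N (X n) (voronoi (X n)) _ _ (uX n) _ (bX n) _ _ _ fill P.
rewrite natrX rho0 rho1 expn_gt0 mul1e => /(_ isT isT) FMX.
have {FMX} := FMX (le_trans (fX n) (sX n)) (fun y => voronoi_cover y X0)
  (@voronoi_disjoint (X n)) _ PP.
rewrite (_ : (fun x => cabs (P x) `^ 2) = (fun x => cabs (P x) ^+ 2)); last first.
  by apply/funext => x; rewrite powR_mulrn// cabs_ge0.
rewrite (_ : \sum_(x <- X n) _ = \sum_(x <- X n) w n x * cabs (P x) ^+ 2); last first.
  by rewrite !big_seq; apply: eq_bigr => x xX; rewrite wX// powR_mulrn// cabs_ge0.
have self x : x \in X n ->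
    voronoi (X n) x x /\ voronoi (X n) x `<=` cball x (fill_distance (X n)).
  by move=> xX; split; [exact: voronoi_self | exact: voronoi_cball].
move=> /(_ self); rewrite ler_distl => /andP[h1 h2].
by apply/andP; split; lra.
Qed.
End VoronoiQuadrature.

Theorem proposition5p4 (R : realType) (d : nat) (M : compact_riemannian R d)
    (mu : probability (borel M) R) (hmu : normalized_volume mu)
    (u : nat -> M -> R[i]) (lam : nat -> R) (hu : eigenbasis mu u lam)
    (RM c1 c2 : R) (hball : ball_regular mu RM c1 c2)
    (C1 C2 C3 C4 : R) (hC1 : 0 < C1) (hC2 : 0 < C2) (hC3 : 0 < C3) (hC4 : 0 < C4)
    (c : R) (hc : filbir_mhaskar mu u lam 1 2 c)
    (r : nat) (alpha : R -> R[i]) (beta : 'I_r -> R -> R[i])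
    (a : int -> R[i]) (b : 'I_r -> int -> R[i])
    (hgen : generators_filters alpha beta a b)
    (J K : nat) (hJK : (J < K)%N)
    (hactive : forall j, (J < j)%N ->
      {subset active alpha lam j.-1 <= active alpha lam j})
    (href_alpha : forall xi : R,
      fourier alpha (2 * xi) = symbol a xi * fourier alpha xi)
    (href_beta : forall (k : 'I_r) (xi : R),
      fourier (beta k) (2 * xi) = symbol (b k) xi * fourier alpha xi)
    (hpartition : forall j l : nat, (J < j <= K)%N -> l \in active alpha lam j ->
      cabs (symbol a (lam l / 2 ^+ j)) ^+ 2
        + \sum_(k < r) cabs (symbol (b k) (lam l / 2 ^+ j)) ^+ 2 = 1) :
  (* (i) fixed-tolerance nested Marcinkiewicz-Zygmund measures *)
  (forall (eta gamma : R) (X : nat -> seq M) (w : nat -> M -> R),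
    0 < eta < 1 ->
    nested_MZ mu u lam C1 C2 C3 C4 eta gamma X w ->
    let T := analysis u lam alpha a b X w J K in
    [/\ forall z : coef lam alpha K, frame_bounds T eta z,
        forall (Om : {set active alpha lam K}) (z : coef lam alpha K),
          (forall l : active alpha lam K, l \notin Om -> z l = 0) -> frame_bounds T eta z &
        well_conditioned T eta]) /\
  (* (ii) oversampled analysis operator *)
  (forall (gamma : R) (X : nat -> seq M) (w : nat -> M -> R) (s : nat),
    0 < gamma < RM ->
    nested_voronoi mu C1 C2 gamma X w ->
    let rho := 2 * gamma / c * 2 ^- s in
    rho < 1 ->
    let T := analysis u lam alpha a b
               (fun j => X (j + s)%N) (fun j => w (j + s)%N) J K in
    [/\ forall z : coef lam alpha K, frame_bounds T rho z,
        forall (Om : {set active alpha lam K}) (z : coef lam alpha K),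
          (forall l : active alpha lam K, l \notin Om -> z l = 0) -> frame_bounds T rho z &
        well_conditioned T rho]).

Proof.
have [_ [alpha_supp _] _] := hgen.
(* Both cases reduce to one Marcinkiewicz-Zygmund inequality per level; restriction to a spectral
   subspace is an instance of the bound for all vectors. *)
have conclude eps X w : eps < 1 ->
    (forall j, MZ_level mu u lam eps j (X j) (w j)) ->
    let T := analysis u lam alpha a b X w J K in
    [/\ forall z : coef lam alpha K, frame_bounds T eps z,
        forall (Om : {set active alpha lam K}) (z : coef lam alpha K),
          (forall l : active alpha lam K, l \notin Om -> z l = 0) ->
          frame_bounds T eps z &
        well_conditioned T eps].
  move=> eps1 MZ T; have bounds z : frame_bounds T eps z.
    exact: (analysis_frame_bounds hu alpha_supp hJK hactive href_alpha hpartition).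
  split=> //; apply: frame_well_conditioned => //.
  exact: analysis_linear.
split=> [eta gamma X w /andP[_ eta1] [uX _ _ w0 _ _ MZ]|
  gamma X w s /andP[g0 _] XV rho rho1].
  apply: conclude => // j; split; [exact: uX| |exact: MZ].
  by move=> x /w0; exact: ltW.
(* The oversampled operator is the plain one for nodes and weights shifted by [s] levels. *)
by apply: conclude => // j; exact: voronoi_MZ_level XV rho1.
Qed.
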